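(* Let $h,k$ be integers with $h,k\ge 2$ such that $k$ is coprime to $h$, to $h-1$, and to $2h-1$. Then the polygon $$P_{h,k}=\mathrm{conv}\{(-hk,1-h),\ ((1-h)k,-h),\ ((2h-1)k,-h),\ ((2h-1)k,1-h),\ ((1-h)k,2h-1),\ (-hk,2h-1)\}$$ is a Kähler–Einstein Fano polygon which is not symmetric. Moreover, $P_{h,k}$ is of type $B_\infty$. If furthermore $k\ge 2h-1$, then $P_{h,k}$ is not minimal.
   Context: Let $N=\mathbb{Z}^2$, $M=\mathrm{Hom}(N,\mathbb{Z})$, $N_{\mathbb{Q}}=N\otimes\mathbb{Q}$, $M_{\mathbb{Q}}=M\otimes\mathbb{Q}$. A convex lattice polygon $P\subset N_{\mathbb{Q}}$ is Fano if the origin lies in its strict interior and every vertex $(x,y)$ satisfies $\gcd(x,y)=1$. The dual of $P$ is $P^*=\{u\in M_{\mathbb{Q}} : u(x)\ge -1\ \forall x\in P\}$; a Fano polygon is Kähler–Einstein if the barycentre (centroid) of $P^*$ is the origin. With $\mathrm{Aut}(P)=\{G\in \mathrm{GL}_2(\mathbb{Z}) : GP=P\}$, $P$ is symmetric if the only point of $N_{\mathbb{Q}}$ fixed by all of $\mathrm{Aut}(P)$ is $0$. Barycentric transformation: for a Fano polygon $P$ with vertices $v_1,\dots,v_m$ in anticlockwise order, $B(P)$ is the convex hull of the points $\frac{v_i+v_{i+1}}{\gcd(v_i+v_{i+1})}$, $i=1,\dots,m$ (indices modulo $m$), where $\gcd(v)$ is the gcd of the coordinates of $v$. Put $B^1(P)=B(P)$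 and $B^{k+1}(P)=B^k(B(P))$. $P$ is of type $B_\infty$ if $B^k(P)$ is Fano for every integer $k\ge1$. Mutation: let $P$ be a Fano polygon and $w\in M$ primitive. Put $h_{\min}=\min_{x\in P}w(x)$, $h_{\max}=\max_{x\in P}w(x)$. For an integer $h$ let $N_h=\{x\in N: w(x)=h\}$, $P_h=\mathrm{conv}(P\cap N_h)$, and let $\mathcal{V}(P)_h$ be the set of vertices of $P$ lying in $N_h$. A lattice polytope $F\subset N_{\mathbb{Q}}$ is a factor of $P$ with respect to $w$ if $w(F)=\{0\}$ and for every integer $h$ with $h_{\min}\le h<0$ there is a (possibly empty) lattice polytope $R_h\subset N_{\mathbb{Q}}$ with $\mathcal{V}(P)_h\subseteq R_h+|h|F\subseteq P_h$. The mutation of $P$ with respect to $w$ and $F$ is $\mathrm{mut}_w(P,F)=\mathrm{conv}\big(\bigcup_{h=h_{\min}}^{-1}R_h\cup\bigcup_{h=0}^{h_{\max}}(P_h+hF)\big)$ (it does not depend on the choice of the $R_h$). A Fano polygon $P$ is minimal if $|\partial P\cap N|\le|\partial Q\cap N|$ for every mutation $Q=\mathrm{mut}_w(P,F)$ of $P$. *)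

(* Defs.v *)
From HB Require Import structures.
From mathcomp Require Import all_boot all_order all_algebra.
From mathcomp Require Import all_classical all_reals all_analysis.

Set Implicit Arguments.
Unset Strict Implicit.
Unset Printing Implicit Defensive.

Import Order.TTheory GRing.Theory Num.Theory.
Import numFieldNormedType.Exports.

Local Open Scope classical_set_scope.
Local Open Scope card_scope.
Local Open Scope ring_scope.

(* NZ is the lattice N of integer column vectors; MZ is its dual M, the integer
   row vectors acting on NZ by matrix multiplication; NQ is N_Q. *)
Notation NZ := 'cV[int]_2.
Notation MZ := 'rV[int]_2.
Notation NQ := 'cV[rat]_2.

Definition vec (a b : int) : NZ := \col_i (if i == 0 then a else b).

Definition toNQ (v : NZ) : NQ := map_mx intr v.

Definition gcd_vec (v : NZ) : int := gcdz (v 0 0) (v 1 0).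

Definition conv (A : set NQ) : set NQ :=
  smallest (fun C : set NQ => convex_set (C : set (convex_lmodType NQ))) A.

(* Possibly empty, and possibly of dimension less than 2. *)
Definition lattice_polytope (P : set NQ) : Prop :=
  exists s : seq NZ, P = conv (toNQ @` [set` s]).

Definition vertex (P : set NQ) (x : NQ) : Prop :=
  P x /\ forall (y z : NQ) (t : rat), P y -> P z -> 0 < t -> t < 1 ->
    x = t *: y + (1 - t) *: z -> y = x /\ z = x.

(* The definition is generic because the canonical topology on matrices is
   not found by unification when the field is the closed term [rat]. *)
Definition strict_interior_in (F : numFieldType) (P : set 'cV[F]_2)
  : set 'cV[F]_2 := interior P.

Definition strict_interior (P : set NQ) : set NQ := strict_interior_in P.

(* A polygon is closed, so this is its topological boundary. *)
Definition boundary (P : set NQ) : set NQ := P `\` strict_interior P.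

Definition fano (P : set NQ) : Prop :=
  [/\ lattice_polytope P, strict_interior P 0 &
      forall v : NZ, vertex P (toNQ v) -> gcd_vec v = 1].

(* The set of K-points of the dual polygon, for an ordered field K. *)
Definition dual (K : realFieldType) (P : set NQ) : set 'rV[K]_2 :=
  [set u | forall x : NQ, P x -> -1 <= (u *m map_mx ratr x) 0 0].
Arguments dual K P : clear implicits.

Definition row2 (T : Type) (p : T * T) : 'rV[T]_2 :=
  \row_i (if i == 0 then p.1 else p.2).

(* The centroid of a planar set of positive finite area, for the Lebesgue
   measure of R * R transported by [row2]. *)
Definition barycentre (R : realType) (A : set 'rV[R]_2) : 'rV[R]_2 :=
  let mu := (@lebesgue_measure R \x @lebesgue_measure R)%E in
  let D := @row2 R @^-1` A in
  (fine (mu D))^-1 *: \row_i (\int[mu]_(p in D) (row2 p 0 i))%R.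

(* The rational dual polygon has measure zero in the real plane, so its
   centroid is computed on its real points. *)
Definition kahler_einstein (R : realType) (P : set NQ) : Prop :=
  barycentre (dual R P) = 0.

Definition Aut (P : set NQ) : set 'M[int]_2 :=
  [set G | G \in unitmx /\ mulmx (map_mx intr G : 'M[rat]_2) @` P = P].

Definition symmetric_polygon (P : set NQ) : Prop :=
  forall x : NQ,
    (forall G, Aut P G -> (map_mx intr G : 'M[rat]_2) *m x = x) -> x = 0.

Definition orient (a b c : NZ) : int :=
  (b 0 0 - a 0 0) * (c 1 0 - a 1 0) - (b 1 0 - a 1 0) * (c 0 0 - a 0 0).

(* [s] lists the vertices of the lattice polygon [P] in anticlockwise order:
   any three of them, taken in the order of the list, form a positively
   oriented triangle. The list is unique up to rotation. *)
Definition anticlockwise_vertices (P : set NQ) (s : seq NZ) : Prop :=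
  [/\ uniq s, (forall v : NZ, v \in s <-> vertex P (toNQ v)) &
      forall i j l : nat, (i < j)%N -> (j < l)%N -> (l < size s)%N ->
        0 < orient (nth 0 s i) (nth 0 s j) (nth 0 s l)].

Definition primitive_multiple (v : NZ) : NQ :=
  (gcd_vec v)%:~R^-1 *: toNQ v.

(* [next s v] is the cyclic successor of [v] in [s]. *)
Definition barycentric (P : set NQ) : set NQ :=
  conv [set x | exists s : seq NZ, anticlockwise_vertices P s /\
    exists2 v, v \in s & x = primitive_multiple (v + next s v)].

Definition type_Binfty (P : set NQ) : Prop :=
  forall n : nat, (1 <= n)%N -> fano (iter n barycentric P).

Definition primitive_form (w : MZ) : Prop := gcdz (w 0 0) (w 0 1) = 1.

Definition height (w : MZ) (x : NQ) : rat := (map_mx intr w *m x) 0 0.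

(* Extrema of [w] on a lattice polytope; they are attained at lattice points,
   hence are integers. The default value 0 is only used for empty sets. *)
Definition hmin (w : MZ) (P : set NQ) : int :=
  xget 0 [set m : int | (height w @` P) m%:~R /\
    forall x, P x -> m%:~R <= height w x].
Definition hmax (w : MZ) (P : set NQ) : int :=
  xget 0 [set m : int | (height w @` P) m%:~R /\
    forall x, P x -> height w x <= m%:~R].

Definition layer (w : MZ) (h : int) : set NQ :=
  toNQ @` [set v : NZ | (w *m v) 0 0 = h].

Definition slice (w : MZ) (P : set NQ) (h : int) : set NQ :=
  conv (P `&` layer w h).

Definition vertices_at (w : MZ) (P : set NQ) (h : int) : set NQ :=
  vertex P `&` layer w h.

Definition minkowski (A B : set NQ) : set NQ :=
  [set x + y | x in A & y in B].

Definition dilate (c : int) (A : set NQ) : set NQ :=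
  [set c%:~R *: x | x in A].

(* The polytopes [R_ h] witness that [F] is a factor of [P]; only the values at
   hmin <= h < 0 matter. *)
Definition factor_witness (w : MZ) (P F : set NQ) (R_ : int -> set NQ) : Prop :=
  forall h : int, hmin w P <= h -> h < 0 ->
    [/\ lattice_polytope (R_ h),
        vertices_at w P h `<=` minkowski (R_ h) (dilate `|h| F) &
        minkowski (R_ h) (dilate `|h| F) `<=` slice w P h].

Definition mutation (w : MZ) (P F : set NQ) (R_ : int -> set NQ) : set NQ :=
  conv ((\bigcup_(h in [set h : int | hmin w P <= h < 0]) R_ h) `|`
        (\bigcup_(h in [set h : int | 0 <= h <= hmax w P])
           minkowski (slice w P h) (dilate h F))).

Definition is_mutation (P Q : set NQ) : Prop :=
  exists (w : MZ) (F : set NQ) (R_ : int -> set NQ),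
    [/\ primitive_form w, lattice_polytope F, height w @` F = [set 0],
        factor_witness w P F R_ & Q = mutation w P F R_].

Definition boundary_lattice_points (P : set NQ) : set NZ :=
  toNQ @^-1` boundary P.

(* Minimality of a Fano polygon. The sets compared are finite, so that [#<=]
   compares their numbers of elements. *)
Definition minimal_polygon (P : set NQ) : Prop :=
  forall Q, is_mutation P Q ->
    boundary_lattice_points P #<= boundary_lattice_points Q.

Definition Phk (h k : int) : set NQ :=
  conv (toNQ @` [set` [:: vec (- (h * k)) (1 - h);
                          vec ((1 - h) * k) (- h);
                          vec ((2 * h - 1) * k) (- h);
                          vec ((2 * h - 1) * k) (1 - h);
                          vec ((1 - h) * k) (2 * h - 1);
                          vec (- (h * k)) (2 * h - 1)]]).

(* Main.v *)
Require Import Defs.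
From mathcomp Require Import all_boot all_order all_algebra.
From mathcomp Require Import all_classical all_reals all_analysis.
From mathcomp Require Import measurable_realfun ring lra zify.

(**
Divided by k in the first coordinate, the polygon Phk h k becomes the hexagon
whose corners, completed by a third coordinate making the sum zero, are the six
permutations of (-h, 1 - h, 2h - 1). The symmetric group on three letters acts
on it, hence acts rationally on Phk h k; the first claim below comes from this
action, and the second from how little of it preserves the lattice.

- Kähler-Einstein. Two transpositions act on the dual polygon as
  (a, b) |-> (-a, b - k a) and (a, b) |-> (a - b / k, -b). They preserve planar
  Lebesgue measure and each changes the sign of one coordinate, so both
  first moments vanish ([Rintegral_odd], [kahler_einstein_odd]).
- Not symmetric. The second coordinate varies by 3h - 1 on Phk h k, while the
  lower edge has length (3h - 2) k, too long for an integral automorphism to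
  tilt it. Therefore automorphisms preserve the second coordinate, and then only
  the identity and one transposition remain, both of which fix (-k, 2)
  ([hexagon_endomorphism]).
- Type B_infinity. As k is coprime to h (h - 1), it is odd, say k = 2m + 1.
  In each sum of adjacent vertices of Phk h k the factor h or 2h - 1 divides
  out, which leaves a hexagon depending on k alone. Two more steps lead to
  the parallelogram with vertices (k, -2), (1, 0), (-k, 2), (-1, 0), and from
  there the transformation alternates between this parallelogram and the one
  with vertices (m + 1, -1), (-m, 1), (-m - 1, 1), (m, -1).
- Not minimal. Mutate with respect to w = (0, -1) with the unit horizontal
  segment as factor. The top edge has length k >= 2h - 1, so it can lose 2h - 1
  lattice points, whereas the bottom edge gains h; the points between the two
  edges are only sheared by (x, y) |-> (x - y, y) on the right-hand side. The
  boundary loses h - 1 >= 1 lattice points ([boundary_map]).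

Two facts of plane geometry carry the translation to convex hulls. A fan of
triangles shows that a point to the left of every edge of a closed polygonal
line lies in the hull of its corners ([fan_conv]); this gives membership and
interior points. In a list in convex position the successor of a corner is the
only other corner with all the remaining ones to the left of the edge joining
them, so any two such lists of the vertices of a polygon give the same edges
([convex_position_next]); this evaluates the barycentric transformation on an
explicit list ([barycentric_hullE]).
*)

Set Implicit Arguments.
Unset Strict Implicit.
Unset Printing Implicit Defensive.

Import Order.TTheory GRing.Theory Num.Theory.
Import numFieldNormedType.Exports.
Import Defs.

Local Open Scope classical_set_scope.
Local Open Scope card_scope.
Local Open Scope ring_scope.

(** * Lattice and rational points of the plane *)

Lemma vec_ext (T : Type) (x y : 'cV[T]_2) :
  x 0 0 = y 0 0 -> x 1 0 = y 1 0 -> x = y.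
Proof.
move=> e0 e1; apply/matrixP => i j; rewrite ord1.
by case: i => [[|[|]]] // i; [move: e0|move: e1]; congr (x _ 0 = y _ 0);
  apply/val_inj.
Qed.

Lemma vec_eta (v : NZ) : v = vec (v 0 0) (v 1 0).
Proof. by apply: vec_ext; rewrite !mxE. Qed.

Lemma vec_inj a b c d : vec a b = vec c d -> a = c /\ b = d.
Proof.
by move=> /matrixP E; have := E 0 0; have := E 1 0; rewrite !mxE.
Qed.

Lemma toNQ_inj : injective toNQ.
Proof.
by move=> a b /matrixP E; apply: vec_ext; [have := E 0 0|have := E 1 0];
  rewrite !mxE => /intr_inj.
Qed.

Lemma toNQ_vecE a b :
  (toNQ (vec a b) 0 0 = a%:~R) * (toNQ (vec a b) 1 0 = b%:~R).
Proof. by rewrite !mxE. Qed.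

Lemma mulmx2E (T : pzSemiRingType) m n (A : 'M[T]_(m, 2))
    (B : 'M[T]_(2, n)) i j :
  (A *m B) i j = A i 0 * B 0 j + A i 1 * B 1 j.
Proof.
by rewrite !mxE !big_ord_recl big_ord0 addr0; congr (_ + A i _ * B _ _);
  apply/val_inj.
Qed.

Lemma gcd_vecE a b : gcd_vec (vec a b) = gcdz a b.
Proof. by rewrite /gcd_vec !mxE. Qed.

Lemma vecD a b c d : vec a b + vec c d = vec (a + c) (b + d).
Proof. by apply: vec_ext; rewrite !mxE. Qed.

Lemma vecZ g a b : g *: vec a b = vec (g * a) (g * b).
Proof. by apply: vec_ext; rewrite !mxE. Qed.

Lemma vec0 : 0 = vec 0 0.
Proof. by apply: vec_ext; rewrite !mxE. Qed.

(** * Convex hulls and half-planes *)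

(** Convexity with a bare rational coefficient, so that linear arithmetic
    applies to it directly; equivalent to the bundled notion by
    [convex_setE]. *)
Definition convexQ (C : set NQ) : Prop := forall x y (t : rat),
  C x -> C y -> 0 <= t -> t <= 1 -> C (t *: x + (1 - t) *: y).

Lemma convex_setE (C : set NQ) :
  convex_set (C : set (convex_lmodType NQ)) <-> convexQ C.
Proof.
split=> cC x y t.
  move=> Cx Cy t0 t1; have := cC x y (Itv01 t0 t1).
  by move=> /(_ (mem_set Cx) (mem_set Cy)) /set_mem.
move=> /set_mem Cx /set_mem Cy; apply/mem_set.
by apply: (cC x y t%:num).
Qed.

Lemma sub_conv A : A `<=` conv A.
Proof. exact: sub_smallest. Qed.

Lemma conv_min (A C : set NQ) : convexQ C -> A `<=` C -> conv A `<=` C.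
Proof. by move=> /convex_setE cC; apply: smallest_sub. Qed.

Lemma conv_convex A : convexQ (conv A).
Proof.
move=> x y t Ax Ay t0 t1 C CA; have [/convex_setE cC _] := CA.
by apply: cC => //; [exact: Ax CA|exact: Ay CA].
Qed.

Lemma sub_conv_conv (A B : set NQ) : A `<=` conv B -> conv A `<=` conv B.
Proof. exact: conv_min (@conv_convex B). Qed.

Lemma convex3 (C : set NQ) x y z (a b c : rat) : convexQ C -> C x -> C y -> C z ->
  0 <= a -> 0 <= b -> 0 <= c -> a + b + c = 1 ->
  C (a *: x + b *: y + c *: z).
Proof.
move=> cC Cx Cy Cz a0 b0 c0 abc; have [ab0|abN0] := eqVneq (a + b) 0.
  have -> : a = 0 by lra.
  have -> : b = 0 by lra.
  have -> : c = 1 by lra.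
  by rewrite !scale0r !add0r scale1r.
have ab_gt0 : 0 < a + b by lra.
have := cC _ _ (a + b) (cC _ _ (a / (a + b)) Cx Cy _ _) Cz.
rewrite scalerDr !scalerA.
have -> : (a + b) * (a / (a + b)) = a by field.
have -> : (a + b) * (1 - a / (a + b)) = b by field.
have -> : 1 - (a + b) = c by lra.
apply; rewrite ?divr_ge0 ?ler_pdivrMr //; lra.
Qed.

Definition affine_form (F : realFieldType) (c : F * F * F) (x : 'cV[F]_2) : F :=
  c.1.1 * x 0 0 + c.1.2 * x 1 0 + c.2.

Lemma affine_form_comb (F : realFieldType) (c : F * F * F) (t : F) x y :
  affine_form c (t *: x + (1 - t) *: y) =
    t * affine_form c x + (1 - t) * affine_form c y.
Proof. by rewrite /affine_form !mxE; ring. Qed.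

Lemma halfplane_convex c : convexQ [set x | 0 <= affine_form c x].
Proof.
move=> x y t /= x0 y0 t0 t1; rewrite affine_form_comb addr_ge0 // mulr_ge0 //; lra.
Qed.

Lemma conv_halfplane (A : set NQ) c : (forall x, A x -> 0 <= affine_form c x) ->
  forall x, conv A x -> 0 <= affine_form c x.
Proof. exact: conv_min (@halfplane_convex c). Qed.

(** Each affine form is Lipschitz for the sup norm with constant the sum of
    the absolute values of its linear coefficients, which gives an explicit
    ball on which it remains positive. *)
Lemma interior_halfplanes (F : realFieldType) (cs : seq (F * F * F))
    (A : set 'cV[F]_2) x :
  (forall y, (forall c, c \in cs -> 0 < affine_form c y) -> A y) ->
  (forall c, c \in cs -> 0 < affine_form c x) -> strict_interior_in A x.
Proof.
move=> csA csx; apply: (@filterS _ (nbhs x)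
  (nbhs_filter x) [set y | forall c, c \in cs -> 0 < affine_form c y]).
  by move=> y; exact: csA.
elim: cs csx {csA} => [|c cs IH] csx.
  by apply: filterS (@filterT _ (nbhs x) _) => y _ d.
have {}IH : nbhs x [set y | forall c, c \in cs -> 0 < affine_form c y].
  by apply: IH => d dcs; apply: csx; rewrite inE dcs orbT.
have cx : 0 < affine_form c x by apply: csx; rewrite mem_head.
have N : nbhs x [set y | 0 < affine_form c y].
  have M0 : 0 < `|c.1.1| + `|c.1.2| + 1.
    by rewrite ltr_wpDl ?addr_ge0.
  pose e := affine_form c x / (`|c.1.1| + `|c.1.2| + 1).
  have e0 : 0 < e by rewrite divr_gt0.
  apply/nbhs_ballP; exists e => //= y [_ xy].
  have {}xy i : `|x i 0 - y i 0| < e by exact: xy.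
  have E : affine_form c x = affine_form c y +
      (c.1.1 * (x 0 0 - y 0 0) + c.1.2 * (x 1 0 - y 1 0)).
    by rewrite /affine_form; ring.
  have L : `|c.1.1 * (x 0 0 - y 0 0) + c.1.2 * (x 1 0 - y 1 0)|
      <= (`|c.1.1| + `|c.1.2|) * e.
    rewrite mulrDl (le_trans (ler_normD _ _)) // !normrM lerD //.
      by rewrite ler_wpM2l // ltW.
    by rewrite ler_wpM2l // ltW.
  have Ee : (`|c.1.1| + `|c.1.2| + 1) * e = affine_form c x.
    by rewrite /e mulrC divfK // gt_eqF.
  move: L; rewrite ler_norml => /andP[_ L]; rewrite /=.
  move: E Ee L e0.
  move: (affine_form c x) (affine_form c y) e (_ * _ + _) {IH cx xy} => ax ay e d.
  move: (`|_|) (`|_|) => a b -> *; nra.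
apply: filterS (filterI N IH) => y [cy csy] d.
by rewrite inE => /predU1P[->|/csy].
Qed.

(** A small step against the signs of the linear coefficients decreases the
    form, hence leaves the half-plane that contains [A]. *)
Lemma supporting_line_not_interior (F : realFieldType) (c : F * F * F)
    (A : set 'cV[F]_2) x :
  (c.1.1 != 0) || (c.1.2 != 0) -> (forall y, A y -> 0 <= affine_form c y) ->
  affine_form c x = 0 -> ~ strict_interior_in A x.
Proof.
move=> cN0 Ac cx /nbhs_ballP[e /= e0 eA].
pose d : 'cV[F]_2 := \col_i (if i == 0 then Num.sg c.1.1 else Num.sg c.1.2).
have /Ac : A (x - (e / 2) *: d).
  apply: eA; split=> // i j; rewrite /ball /= !mxE ord1 opprB addrC subrK.
  have e2 : `|e / 2| = e / 2 by rewrite gtr0_norm // divr_gt0.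
  have E : e / 2 < e by lra.
  case: ifP => _; rewrite normrM e2 normr_sg; case: (_ == 0) => /=; lra.
have -> : affine_form c (x - (e / 2) *: d) =
    affine_form c x - e / 2 * (`|c.1.1| + `|c.1.2|).
  by rewrite /affine_form !mxE /= !normrEsg; ring.
rewrite cx sub0r oppr_ge0 => H; have : 0 < e / 2 * (`|c.1.1| + `|c.1.2|).
  rewrite mulr_gt0 ?divr_gt0 //; case/orP: cN0 => H0.
    by rewrite ltr_pwDl // normr_gt0.
  by rewrite ltr_wpDl // normr_gt0.
lra.
Qed.

Lemma strict_interior_sub (F : realFieldType) (A : set 'cV[F]_2) :
  strict_interior_in A `<=` A.
Proof. exact: interior_subset. Qed.

Lemma halfplanes_convex cs :
  convexQ [set x | all (fun c => 0 <= affine_form c x) cs].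
Proof.
move=> x y t /= /allP xc /allP yc t0 t1; apply/allP => c cs_c.
by apply: halfplane_convex => //=; [exact: xc|exact: yc].
Qed.

Definition orientQ (a b c : NQ) : rat :=
  (b 0 0 - a 0 0) * (c 1 0 - a 1 0) - (b 1 0 - a 1 0) * (c 0 0 - a 0 0).

(** The coefficients of [orientQ a b] as an affine form in its last argument:
    its nonnegative half-plane lies to the left of the edge from [a] to [b]. *)
Definition edge_form (a b : NQ) : rat * rat * rat :=
  (a 1 0 - b 1 0, b 0 0 - a 0 0, a 0 0 * b 1 0 - a 1 0 * b 0 0).

Lemma affine_form_edge a b x : affine_form (edge_form a b) x = orientQ a b x.
Proof. by rewrite /affine_form /orientQ /=; ring. Qed.

Lemma orientQ_toNQ a b c :
  orientQ (toNQ a) (toNQ b) (toNQ c) = (orient a b c)%:~R.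
Proof. by rewrite /orientQ /orient /toNQ !mxE !(rmorphM, rmorphB). Qed.

(** The three orientations, divided by their sum, are the barycentric
    coordinates of [x] in the triangle. *)
Lemma triangle_conv (C : set NQ) a b c x : convexQ C -> C a -> C b -> C c ->
  0 < orientQ a b x -> 0 <= orientQ b c x -> 0 <= orientQ c a x -> C x.
Proof.
move=> cC Ca Cb Cc abx bcx cax.
set S := orientQ a b x + orientQ b c x + orientQ c a x.
have S0 : 0 < S by rewrite /S; lra.
have SE : S = orientQ a b c by rewrite /S /orientQ; ring.
have SN0 : orientQ a b c != 0 by rewrite -SE gt_eqF.
have -> : x = (orientQ b c x / S) *: a + (orientQ c a x / S) *: b
   + (orientQ a b x / S) *: c.
  by apply: vec_ext; rewrite !mxE SE /orientQ; field; exact: SN0.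
apply: convex3 => //; rewrite ?divr_ge0 ?(ltW S0) ?(ltW abx) //.
by rewrite -!mulrDl addrC addrA divff // gt_eqF.
Qed.

(** Cut the closed polygonal line a, b, s, a into triangles with apex [a].
    The side of [x] with respect to the ray from [a] through a corner is
    positive at [b] and would be negative at the last corner, so it changes
    sign between two consecutive corners; their triangle contains [x].
    Strictness at the first edge makes this triangle nondegenerate, even if
    the line repeats corners. *)
Lemma fan_conv (C : set NQ) (a b : NQ) s x : convexQ C -> C a -> C b ->
  (forall v, v \in s -> C v) -> 0 < orientQ a b x ->
  path (fun u v => 0 <= orientQ u v x) b (rcons s a) -> C x.
Proof.
move=> cC Ca; elim: s b => [|c s IH] b Cb Cs abx /=.
  rewrite andbT => bax; exfalso; move: abx bax; rewrite /orientQ; lra.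
move=> /andP[bcx pcs]; have Cc : C c by apply: Cs; rewrite mem_head.
have [acx|acx] := ltP 0 (orientQ a c x).
  by apply: (IH c) => // v vs; apply: Cs; rewrite inE vs orbT.
apply: (triangle_conv cC Ca Cb Cc) => //.
by move: acx; rewrite /orientQ; lra.
Qed.

(** Removing an extreme point from a convex set leaves a convex set. *)
Lemma vertex_conv A x : vertex (conv A) x -> A x.
Proof.
move=> [Ax ext]; apply: contrapT => nAx.
suff /(_ x Ax) [] : conv A `<=` [set y | conv A y /\ y <> x] by [].
apply: conv_min => [y z t [Ay yx] [Az zx] t0 t1|y Ay]; last first.
  by split; [exact: sub_conv|move=> yx; apply: nAx; rewrite -yx].
split; first exact: conv_convex.
have [->|tN0] := eqVneq t 0; first by rewrite scale0r subr0 scale1r add0r.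
have [->|tN1] := eqVneq t 1; first by rewrite scale1r subrr scale0r addr0.
move=> /esym E; apply: yx.
by apply: (proj1 (ext y z t Ay Az _ _ E));
  rewrite lt_neqAle ?t0 ?t1 ?tN1 1?eq_sym ?tN0.
Qed.

(** The points where the form is positive, together with [v], form a convex
    set. *)
Lemma exposed_vertex A c v : A v -> affine_form c v = 0 ->
  (forall u, A u -> u <> v -> 0 < affine_form c u) -> vertex (conv A) v.
Proof.
move=> Av cv cA.
have cC : convexQ [set y | y = v \/ 0 < affine_form c y].
  move=> y z t /= Cy Cz t0 t1.
  have [-> | tN0] := eqVneq t 0; first by rewrite scale0r subr0 scale1r add0r.
  have [-> | tN1] := eqVneq t 1; first by rewrite scale1r subrr scale0r addr0.
  have tgt0 : 0 < t by rewrite lt_neqAle t0 eq_sym tN0.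
  have tlt1 : 0 < 1 - t by rewrite subr_gt0 lt_neqAle t1 tN1.
  rewrite affine_form_comb; case: Cy Cz => [->|y0] [->|z0].
  - by left; rewrite -scalerDl addrC subrK scale1r.
  - by right; rewrite cv mulr0 add0r mulr_gt0.
  - by right; rewrite cv mulr0 addr0 mulr_gt0.
  - by right; rewrite addr_gt0 // mulr_gt0.
have sub : conv A `<=` [set y | y = v \/ 0 < affine_form c y].
  apply: conv_min => // u Au; have [->|/eqP uv] := eqVneq u v; first by left.
  by right; apply: cA.
split=> [|y z t Ay Az t0 t1 E]; first exact: sub_conv.
have t1' : 0 < 1 - t by rewrite subr_gt0.
have Z : t * affine_form c y + (1 - t) * affine_form c z = 0.
  by rewrite -affine_form_comb -E.
case: (sub y Ay) (sub z Az) => [yv|y0] [zv|z0] //; exfalso; move: Z.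
- by rewrite yv cv mulr0 add0r => /eqP; rewrite gt_eqF // mulr_gt0.
- by rewrite zv cv mulr0 addr0 => /eqP; rewrite gt_eqF // mulr_gt0.
- by move/eqP; rewrite gt_eqF // addr_gt0 // mulr_gt0.
Qed.

(** * Lattice polygons given by lists of corners *)

Definition lattice_hull (s : seq NZ) : set NQ := conv (toNQ @` [set` s]).

Lemma mem_hull s v : v \in s -> lattice_hull s (toNQ v).
Proof. by move=> vs; apply: sub_conv; exists v. Qed.

Lemma vertex_hull s v : vertex (lattice_hull s) (toNQ v) -> v \in s.
Proof. by move/vertex_conv => [u /= us /toNQ_inj <-]. Qed.

Definition convex_position (s : seq NZ) : Prop :=
  (2 < size s)%N /\
  forall i j l : nat, (i < j)%N -> (j < l)%N -> (l < size s)%N ->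
    0 < orient (nth 0 s i) (nth 0 s j) (nth 0 s l).

Lemma orient_rot a b c : orient b c a = orient a b c.
Proof. by rewrite /orient; ring. Qed.

Lemma orient_swap a b c : orient a c b = - orient a b c.
Proof. by rewrite /orient; ring. Qed.

Lemma orient_refl a b :
  (orient a b b = 0) * (orient b b a = 0) * (orient b a b = 0).
Proof. by rewrite /orient; do !split; ring. Qed.

Lemma convex_position_uniq s : convex_position s -> uniq s.
Proof.
move=> [s2 H]; apply/(uniqPn 0) => -[i [j [ij js eij]]].
have [l []] : exists l, (l < size s)%N /\ (l != i) && (l != j).
  case: (eqVneq i 0%N) => [i0|iN0]; last by exists 0%N; lia.
  case: (eqVneq j 1%N) => [j1|jN1]; last by exists 1%N; lia.
  by exists 2%N; lia.
move=> ls /andP[li lj]; have [lti|gti|] := ltngtP l i; last by lia.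
  have := H l i j lti ij js; rewrite eij orient_refl; lia.
have [ltj|gtj|] := ltngtP l j; last by lia.
  by have := H i l j gti ltj js; rewrite eij orient_refl; lia.
by have := H i j l ij gtj ls; rewrite eij orient_refl; lia.
Qed.

Lemma next_nth_rot (s : seq NZ) i : uniq s -> (i < size s)%N ->
  next s (nth 0 s i) = nth 0 (rot 1 s) i.
Proof.
move=> us is_; rewrite next_nth mem_nth // index_uniq //.
case: s us is_ => // y p us; rewrite ltnS /= rot1_cons nth_rcons.
rewrite leq_eqVlt => /predU1P[->|ip]; last first.
  by rewrite ip; apply: set_nth_default.
by rewrite nth_default // ltnn eqxx.
Qed.

(** The one index computation behind the theory: in a list in convex position
    every edge, including the one that closes the list, has the other corners
    on its left. *)
Lemma next_orient s u v : convex_position s -> v \in s -> u \in s ->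
  u != v -> u != next s v -> 0 < orient v (next s v) u.
Proof.
move=> cs; have us := convex_position_uniq cs; move: cs => [s2 H].
move=> /(nthP 0)[i si <-] /(nthP 0)[j sj <-].
rewrite next_nth_rot // (nth_uniq 0) // => ji.
have [Si|Si] := ltnP i.+1 (size s).
  have -> : nth 0 (rot 1 s) i = nth 0 s i.+1.
    by rewrite /rot nth_cat size_drop ltn_subRL add1n Si nth_drop add1n.
  rewrite (nth_uniq 0) // => jSi.
  have [lt|gt|] := ltngtP j i; last by lia.
    by rewrite orient_rot; apply: H.
  by apply: H => //; lia.
have Es : size s = i.+1 by apply/eqP; rewrite eqn_leq Si si.
rewrite Es in s2 sj.
have -> : nth 0 (rot 1 s) i = nth 0 s 0.
  rewrite /rot nth_cat size_drop Es subn1 /= ltnn subnn nth_take //.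
rewrite (nth_uniq 0) // ?Es // => j0.
by rewrite -orient_rot; apply: H; rewrite ?Es //; lia.
Qed.

(** If the two successors differed, each would lie to the left of the edge
    from [v] to the other one. *)
Lemma convex_position_next s s' v : convex_position s -> convex_position s' ->
  s =i s' -> v \in s -> next s v = next s' v.
Proof.
move=> cs cs' E vs; apply/eqP/negP => /negP Ne.
have N t u : convex_position t -> u \in t -> next t u != u.
  move=> ct ut; apply/eqP => nu; have tu := convex_position_uniq ct.
  have [w [wt wu]] : exists w, w \in t /\ w != u.
    have t2 : (1 < size t)%N by have [] := ct; lia.
    have t1 := ltnW t2.
    case: (eqVneq (nth 0 t 0) u) => [<-|tu0]; last first.
      by exists (nth 0 t 0); rewrite mem_nth.
    by exists (nth 0 t 1); rewrite mem_nth // nth_uniq.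
  have := next_orient ct ut wt wu; rewrite nu wu => /(_ isT).
  by rewrite orient_refl.
have vs' : v \in s' by rewrite -E.
have := @next_orient s (next s' v) v cs vs.
rewrite E mem_next vs' N // eq_sym Ne => /(_ isT isT isT) A1.
have := @next_orient s' (next s v) v cs' vs'.
rewrite -E mem_next vs N // Ne => /(_ isT isT isT).
rewrite orient_swap; lia.
Qed.

(** A corner is exposed by the sum of the forms of its two edges: both vanish
    there, and at any other corner at least one of them is positive. *)
Lemma hull_vertices s : convex_position s ->
  anticlockwise_vertices (lattice_hull s) s.
Proof.
move=> cs; have us := convex_position_uniq cs; split=> //; last by case: cs.
move=> v; split=> [vs|]; last exact: vertex_hull.
set w := next s v; set p := prev s v.
have ps : p \in s by rewrite mem_prev.
have ws : w \in s by rewrite mem_next.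
have np : next s p = v by rewrite next_prev.
pose c : rat * rat * rat :=
  ((edge_form (toNQ v) (toNQ w)).1.1 + (edge_form (toNQ p) (toNQ v)).1.1,
   (edge_form (toNQ v) (toNQ w)).1.2 + (edge_form (toNQ p) (toNQ v)).1.2,
   (edge_form (toNQ v) (toNQ w)).2 + (edge_form (toNQ p) (toNQ v)).2).
have cE u : affine_form c (toNQ u) = (orient v w u + orient p v u)%:~R.
  rewrite rmorphD /= -!orientQ_toNQ -!affine_form_edge /affine_form /c /=.
  by ring.
apply: (@exposed_vertex _ c); first by exists v.
  by rewrite cE !orient_refl.
move=> _ [u /= uS <-] uv; rewrite cE ltr0z.
have {}uv : u != v by apply/eqP => E; apply: uv; rewrite E.
(* With more than two corners the two neighbours of [v] are distinct. *)
have wp : w != p.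
  have [z [zs zv zw]] : exists z, [/\ z \in s, z != v & z != w].
    have : ~~ all [in [:: v; w]] s.
      apply/negP => /allP /(uniq_leq_size us) /=.
      by rewrite leqNgt; case: cs => ->.
    by move=> /allPn[z zs]; rewrite !inE negb_or => /andP[zv zw]; exists z.
  have := next_orient cs vs zs zv zw.
  apply: contraTneq => wp; have := next_orient cs ps zs.
  rewrite np -wp zw zv => /(_ isT isT).
  by rewrite -leNgt -orient_rot orient_swap oppr_gt0 => /ltW.
have P1 : u != w -> 0 < orient v w u by apply: next_orient.
have P2 : u != p -> 0 < orient p v u.
  by move=> up; rewrite -{1}np; apply: next_orient; rewrite // np.
have [uw|uw] := eqVneq u w.
  by rewrite {1}uw orient_refl add0r P2 // uw.
have [up|up] := eqVneq u p; last by rewrite addr_gt0 ?P1 ?P2.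
by rewrite {2}up orient_refl addr0 P1 // up eq_sym.
Qed.

(** The definition of the transformation ranges over all anticlockwise lists
    of the vertices; they all have the same successor function. *)
Lemma barycentric_hull s : convex_position s -> barycentric (lattice_hull s) =
  conv [set` [seq primitive_multiple (p.1 + p.2) | p <- zip s (rot 1 s)]].
Proof.
move=> cs; have us := convex_position_uniq cs.
rewrite /barycentric; congr conv; apply/seteqP; split=> x /=.
  move=> [s' [[us' vs' os'] [v vss' ->]]].
  have E : s =i s'.
    have [_ vS _] := hull_vertices cs.
    by move=> u; apply/idP/idP; [move/vS/vs'|move/vs'/vS].
  have cs' : convex_position s'.
    have Es : size s' = size s by apply/eqP; rewrite -(uniq_size_uniq us E).
    by split=> //; rewrite Es; case: cs.
  have vs : v \in s by rewrite E.
  rewrite -(convex_position_next cs cs' E vs).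
  move: vs => /(nthP 0)[i si <-]; rewrite next_nth_rot //.
  apply/(nthP 0); exists i; first by rewrite size_map size_zip size_rot minnn.
  rewrite (nth_map (0, 0)) ?size_zip ?size_rot ?minnn //.
  by rewrite nth_zip ?size_rot.
move=> /(nthP 0)[i]; rewrite size_map size_zip size_rot minnn => si.
rewrite (nth_map (0, 0)) ?size_zip ?size_rot ?minnn // nth_zip ?size_rot //= => <-.
exists s; split; first exact: hull_vertices.
by exists (nth 0 s i); rewrite ?mem_nth // next_nth_rot.
Qed.

Lemma primitive_multipleZ (g : int) v : 0 < g -> gcd_vec v = 1 ->
  primitive_multiple (g *: v) = toNQ v.
Proof.
move=> g0 v1; rewrite /primitive_multiple.
have -> : gcd_vec (g *: v) = g.
  by rewrite /gcd_vec !mxE -mulz_gcdr -[gcdz _ _]/(gcd_vec v) v1 mulr1 gtz0_abs.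
by apply: vec_ext; rewrite !mxE rmorphM mulKf // intr_eq0 gt_eqF.
Qed.

(** Form used on explicit lists: [g] holds the content of each sum of
    neighbours, so that no gcd has to be computed, only the primitivity of
    [s'] checked. *)
Lemma barycentric_hullE s g s' : convex_position s ->
  size g = size s -> size s' = size s ->
  all (fun v => gcd_vec v == 1) s' -> all (fun c => 0 < c) g ->
  [seq p.1 + p.2 | p <- zip s (rot 1 s)] = [seq p.1 *: p.2 | p <- zip g s'] ->
  barycentric (lattice_hull s) = lattice_hull s'.
Proof.
move=> cs gs s's /allP s'1 /allP g0 E; rewrite barycentric_hull //.
have -> : [seq primitive_multiple (p.1 + p.2) | p <- zip s (rot 1 s)] =
    [seq toNQ v | v <- s'].
  rewrite (map_comp primitive_multiple (fun p => p.1 + p.2)) E -map_comp.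
  rewrite -[in RHS](@unzip2_zip _ _ g s') ?gs ?s's // -map_comp.
  apply/eq_in_map => p /= pz; apply: primitive_multipleZ.
    by apply: g0; rewrite -(@unzip1_zip _ _ g s') ?gs ?s's // map_f.
  by apply/eqP/s'1; rewrite -(@unzip2_zip _ _ g s') ?gs ?s's // map_f.
congr conv; apply/seteqP; split=> x /=; first by move=> /mapP[v vs ->]; exists v.
by move=> [v vs <-]; apply: map_f.
Qed.

Lemma path_zip_rcons (T : eqType) (e : rel T) (a z : T) t :
  (forall p, p \in zip (a :: t) (rcons t z) -> e p.1 p.2) ->
  path e a (rcons t z).
Proof.
elim: t a => [|b t IH] a H /=; first by rewrite andbT (H (a, z)) // mem_head.
rewrite (H (a, b)) ?mem_head // IH // => p pt; apply: H.
by rewrite inE pt orbT.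
Qed.

(** Being strictly to the left of every edge is an open condition which puts
    a point in the hull. *)
Lemma strict_interior_hull s x : (0 < size s)%N ->
  all (fun p => 0 < orientQ (toNQ p.1) (toNQ p.2) x) (zip s (rot 1 s)) ->
  strict_interior (lattice_hull s) x.
Proof.
move=> s0 /allP H.
apply: (@interior_halfplanes _
  [seq edge_form (toNQ p.1) (toNQ p.2) | p <- zip s (rot 1 s)]); last first.
  by move=> c /mapP[p ps ->]; rewrite affine_form_edge; apply: H.
move=> y cy.
have {H}cy p : p \in zip s (rot 1 s) -> 0 < orientQ (toNQ p.1) (toNQ p.2) y.
  by move=> ps; rewrite -affine_form_edge; apply/cy/map_f.
case: s s0 cy => [|a [|b r]] // _ cy.
  by have := cy (a, a) (mem_head _ _); rewrite /orientQ /=; lra.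
rewrite rot1_cons in cy.
have ps := path_zip_rcons (e := fun u v => 0 < orientQ (toNQ u) (toNQ v) y) cy.
move: ps => /= /andP[aby pr].
have sub u : u \in [:: a, b & r] -> lattice_hull [:: a, b & r] (toNQ u).
  exact: mem_hull.
apply: (@fan_conv _ (toNQ a) (toNQ b) (map toNQ r)) => //.
- exact: conv_convex.
- by apply: sub; rewrite mem_head.
- by apply: sub; rewrite !inE eqxx orbT.
- by move=> _ /mapP[v vr ->]; apply: sub; rewrite !inE vr !orbT.
rewrite -map_rcons path_map; apply: sub_path pr => u v /=; exact: ltW.
Qed.

Lemma orientQ0 u v :
  orientQ (toNQ u) (toNQ v) 0 = (orient u v 0)%:~R.
Proof.
by rewrite -orientQ_toNQ; congr orientQ; apply: vec_ext; rewrite !mxE.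
Qed.

Lemma fano_hull s : convex_position s -> all (fun v => gcd_vec v == 1) s ->
  all (fun p => 0 < orient p.1 p.2 0) (zip s (rot 1 s)) -> fano (lattice_hull s).
Proof.
move=> [s2 _] /allP s1 s0; split; first by exists s.
  apply: strict_interior_hull; first exact: ltn_trans s2.
  by apply: sub_all s0 => p; rewrite orientQ0 ltr0z.
by move=> v /vertex_hull /s1 /eqP.
Qed.

Lemma hull_halfplane s (c : rat * rat * rat) x :
  all (fun v => 0 <= affine_form c (toNQ v)) s ->
  lattice_hull s x -> 0 <= affine_form c x.
Proof. by move=> /allP sc; apply: conv_halfplane => _ [v /sc ? <-]. Qed.

(** * Arithmetic *)

Lemma bezout_coprimez (a b u v : int) : u * a + v * b = 1 -> coprimez a b.
Proof. by move=> E; apply/coprimezP; exists (u, v). Qed.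

(** One of [h] and [h - 1] is even. *)
Lemma odd_of_coprimez (h k : int) : coprimez k h -> coprimez k (h - 1) ->
  exists m, k = 2 * m + 1.
Proof.
have parity (x : int) : exists m, x = 2 * m \/ x = 2 * m + 1.
  by exists (x %/ 2)%Z; lia.
move=> kh kh1; have : coprimez k (h * (h - 1)) by rewrite coprimezMr kh.
have [n ->] : exists n, h * (h - 1) = 2 * n.
  have [q [->|->]] := parity h; first by exists (q * (2 * q - 1)); ring.
  by exists ((2 * q + 1) * q); ring.
have [m [->|->]] := parity k; last by exists m.
by move=> /coprimezP[[u v] /= E]; exfalso; lia.
Qed.

Lemma mulz_eq1 (a b : int) : a * b = 1 -> a = 1 \/ a = -1.
Proof.
move=> ab; have : (a %| 1)%Z by apply/dvdzP; exists b; rewrite mulrC ab.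
by rewrite dvdz1; lia.
Qed.

(** * The polygon and its barycentric transforms *)

Lemma orient_vec a b c d e f : orient (vec a b) (vec c d) (vec e f) =
  (c - a) * (f - b) - (d - b) * (e - a).
Proof. by rewrite /orient !mxE. Qed.

(** On an explicit list this unfolds to a conjunction of polynomial
    inequalities, one for each triple of corners. *)
Fixpoint oriented_triples (s : seq NZ) : bool :=
  if s is a :: t then
    pairwise (fun b c => 0 < orient a b c) t && oriented_triples t
  else true.

Lemma convex_position_triples s : (2 < size s)%N -> oriented_triples s ->
  convex_position s.
Proof.
move=> s2 os; split=> // {s2}; elim: s os => [|a t IH] //= /andP[pt ot].
case=> [|i] [|j] [|l] //; rewrite !ltnS => ij jl lt; last exact: IH.
by move/(pairwiseP 0): pt; apply => //; exact: ltn_trans lt.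
Qed.

Definition Phk_vertices (h k : int) : seq NZ :=
  [:: vec (- (h * k)) (1 - h); vec ((1 - h) * k) (- h);
      vec ((2 * h - 1) * k) (- h); vec ((2 * h - 1) * k) (1 - h);
      vec ((1 - h) * k) (2 * h - 1); vec (- (h * k)) (2 * h - 1)].

Lemma PhkE h k : Phk h k = lattice_hull (Phk_vertices h k).
Proof. by []. Qed.

Lemma Phk_convex_position (h k : int) : 2 <= h -> 2 <= k ->
  convex_position (Phk_vertices h k).
Proof.
move=> h2 k2; apply: convex_position_triples => //=.
by rewrite !orient_vec !andbT; do !(apply/andP; split); nia.
Qed.

(** The corners of the iterates of the barycentric transformation, in
    anticlockwise order: [barycentric1], [barycentric2] and [barycentric3]
    are the first three, and [barycentric4] is the fourth for k = 2m + 1. *)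
Definition barycentric1 (k : int) : seq NZ :=
  [:: vec (- k) (-1); vec k (-2); vec (2 * k) (-1);
      vec k 1; vec (- k) 2; vec (- (2 * k)) 1].

Definition barycentric2 (k : int) : seq NZ :=
  [:: vec 0 (-1); vec k (-1); vec 0 1; vec (- k) 1].

Definition barycentric3 (k : int) : seq NZ :=
  [:: vec k (-2); vec 1 0; vec (- k) 2; vec (-1) 0].

Definition barycentric4 (m : int) : seq NZ :=
  [:: vec (m + 1) (-1); vec (- m) 1; vec (- m - 1) 1; vec m (-1)].

Section BarycentricOrbit.
Variables h k m : int.
Hypotheses (h2 : 2 <= h) (k2 : 2 <= k) (kE : k = 2 * m + 1).

Ltac solve_conv := apply: convex_position_triples => //=;
  rewrite !orient_vec !andbT; do !(apply/andP; split); nia.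

Lemma convex_position_barycentric1 : convex_position (barycentric1 k).
Proof. solve_conv. Qed.

Lemma convex_position_barycentric2 : convex_position (barycentric2 k).
Proof. solve_conv. Qed.

Lemma convex_position_barycentric3 : convex_position (barycentric3 k).
Proof. solve_conv. Qed.

Lemma convex_position_barycentric4 : convex_position (barycentric4 m).
Proof. solve_conv. Qed.

Let ck2 : coprimez k 2.
Proof. by apply: (@bezout_coprimez _ _ 1 (- m)); lia. Qed.

Let cz1 n : coprimez n 1.
Proof. by apply: (@bezout_coprimez _ _ 0 1); rewrite mul0r add0r mulr1. Qed.

Let c1z n : coprimez 1 n.
Proof. by rewrite coprimez_sym cz1. Qed.

Ltac solve_primitive := rewrite ?/barycentric1 ?/barycentric2
  ?/barycentric3 ?/barycentric4 /all !gcd_vecE -!/(coprimez _ _);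
  by rewrite !(coprimezN, coprimeNz, cz1, c1z, ck2).

Lemma primitive_barycentric1 : all (fun v => gcd_vec v == 1) (barycentric1 k).
Proof. solve_primitive. Qed.

Lemma primitive_barycentric2 : all (fun v => gcd_vec v == 1) (barycentric2 k).
Proof. solve_primitive. Qed.

Lemma primitive_barycentric3 : all (fun v => gcd_vec v == 1) (barycentric3 k).
Proof. solve_primitive. Qed.

Lemma primitive_barycentric4 : all (fun v => gcd_vec v == 1) (barycentric4 m).
Proof. solve_primitive. Qed.

Ltac solve_fano :=
  rewrite /= vec0 !orient_vec !andbT; do !(apply/andP; split); nia.

Lemma fano_barycentric1 : fano (lattice_hull (barycentric1 k)).
Proof.
by apply: fano_hull convex_position_barycentric1 primitive_barycentric1 _;
  solve_fano.
Qed.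

Lemma fano_barycentric2 : fano (lattice_hull (barycentric2 k)).
Proof.
by apply: fano_hull convex_position_barycentric2 primitive_barycentric2 _;
  solve_fano.
Qed.

Lemma fano_barycentric3 : fano (lattice_hull (barycentric3 k)).
Proof.
by apply: fano_hull convex_position_barycentric3 primitive_barycentric3 _;
  solve_fano.
Qed.

Lemma fano_barycentric4 : fano (lattice_hull (barycentric4 m)).
Proof.
by apply: fano_hull convex_position_barycentric4 primitive_barycentric4 _;
  solve_fano.
Qed.

Ltac solve_sums :=
  rewrite /= !vecD !vecZ; do !(congr cons; first by congr vec; nia).

Lemma barycentric_Phk :
  barycentric (lattice_hull (Phk_vertices h k)) = lattice_hull (barycentric1 k).
Proof.
apply: (@barycentric_hullE _ [:: 2 * h - 1; h; 2 * h - 1; h; 2 * h - 1; h]) => //.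
- exact: Phk_convex_position.
- exact: primitive_barycentric1.
- by rewrite /= !andbT; lia.
- solve_sums.
Qed.

(** For k > 2 the primitive sums on the horizontal axis fall inside the
    parallelogram, which is why the second iterate has four vertices and not
    six. *)
Lemma mem_barycentric2 v :
  v \in [:: vec 1 0; vec (-1) 0] -> lattice_hull (barycentric2 k) (toNQ v).
Proof.
have k3 : 0 < k - 2 by lia.
move=> vE; apply: (@strict_interior_sub rat); apply: strict_interior_hull => //=.
rewrite !orientQ_toNQ !ltr0z; move: vE; rewrite !inE => /orP[] /eqP ->.
  by rewrite !orient_vec !andbT; do !(apply/andP; split); nia.
by rewrite !orient_vec !andbT; do !(apply/andP; split); nia.
Qed.

Lemma barycentric_barycentric1 :
  barycentric (lattice_hull (barycentric1 k)) = lattice_hull (barycentric2 k).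
Proof.
transitivity (lattice_hull [:: vec 0 (-1); vec k (-1); vec 1 0;
                               vec 0 1; vec (- k) 1; vec (-1) 0]).
  apply: (@barycentric_hullE _ [:: 3; 3; 3 * k; 3; 3; 3 * k]) => //.
  - exact: convex_position_barycentric1.
  - solve_primitive.
  - by rewrite /= !andbT; lia.
  - solve_sums.
apply/seteqP; split; apply: sub_conv_conv => _ [v /= vs <-]; last first.
  by apply: mem_hull; move: vs; rewrite !inE => /or4P[] ->; rewrite ?orbT.
have [v2|v2] := boolP (v \in barycentric2 k); first exact: mem_hull.
apply: mem_barycentric2.
by move: vs v2; rewrite !inE; do 5 case: eqP => //=.
Qed.

Lemma barycentric_barycentric2 :
  barycentric (lattice_hull (barycentric2 k)) = lattice_hull (barycentric3 k).
Proof.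
apply: (@barycentric_hullE _ [:: 1; k; 1; k]) => //.
- exact: convex_position_barycentric2.
- exact: primitive_barycentric3.
- by rewrite /= !andbT; lia.
- solve_sums.
Qed.

Lemma barycentric_barycentric3 :
  barycentric (lattice_hull (barycentric3 k)) = lattice_hull (barycentric4 m).
Proof.
apply: (@barycentric_hullE _ [:: 2; 2; 2; 2]) => //.
- exact: convex_position_barycentric3.
- exact: primitive_barycentric4.
- solve_sums.
Qed.

(** The cycle closes here: the sums give the corners of the third iterate,
    starting from the second one. *)
Lemma barycentric_barycentric4 :
  barycentric (lattice_hull (barycentric4 m)) = lattice_hull (barycentric3 k).
Proof.
have -> : lattice_hull (barycentric3 k) = lattice_hull (rot 1 (barycentric3 k)).
  by congr conv; congr image; apply/funext => v /=; rewrite mem_rot.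
apply: (@barycentric_hullE _ [:: 1; 1; 1; 1]) => //.
- exact: convex_position_barycentric4.
- apply/allP => v; rewrite mem_rot.
  by move: v; apply/allP/primitive_barycentric3.
- solve_sums.
Qed.

Lemma Phk_type_Binfty : type_Binfty (Phk h k).
Proof.
have it n : iter (3 + n) barycentric (Phk h k) =
    if odd n then lattice_hull (barycentric4 m)
    else lattice_hull (barycentric3 k).
  elim: n => [|n IH].
    rewrite PhkE /= barycentric_Phk barycentric_barycentric1.
    by rewrite barycentric_barycentric2.
  rewrite addnS iterS IH /=; case: (odd n) => /=.
    exact: barycentric_barycentric4.
  exact: barycentric_barycentric3.
case=> [|[|[|n]]] // _.
- by rewrite /= PhkE barycentric_Phk; exact: fano_barycentric1.
- rewrite /= PhkE barycentric_Phk barycentric_barycentric1.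
  exact: fano_barycentric2.
- by rewrite -[n.+3]/(3 + n)%N it; case: odd;
    [exact: fano_barycentric4|exact: fano_barycentric3].
Qed.

End BarycentricOrbit.

Lemma Phk_fano (h k : int) : 2 <= h -> 2 <= k ->
  coprimez k h -> coprimez k (h - 1) -> coprimez k (2 * h - 1) -> fano (Phk h k).
Proof.
move=> h2 k2 kh kh1 k2h1; apply: fano_hull; first exact: Phk_convex_position.
  have hh1 : coprimez h (h - 1) by apply: (@bezout_coprimez _ _ 1 (-1)); lia.
  have hh2 : coprimez h (2 * h - 1) by apply: (@bezout_coprimez _ _ 2 (-1)); lia.
  have hh3 : coprimez (h - 1) (2 * h - 1).
    by apply: (@bezout_coprimez _ _ (-2) 1); lia.
  rewrite /= !gcd_vecE -!/(coprimez _ _) !(coprimeNz, coprimezN, coprimezMl).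
  rewrite -(opprB h 1) !(coprimeNz, coprimezN) kh kh1 k2h1 hh1 hh2 hh3.
  by rewrite !(coprimez_sym _ h) hh1 hh2 !(coprimez_sym _ (h - 1)) hh3.
rewrite /= vec0 !orient_vec !andbT; do !(apply/andP; split); nia.
Qed.

(** * Inequalities for the polygon, and its automorphisms *)

(** The sides of the polygon. The form x + k y is the third coordinate of the
    symmetric hexagon up to sign and scale. Kept over any ordered domain, to
    be read at rational points as well as at lattice points. *)
Definition hexagon (F : realDomainType) (h k x y : F) : bool :=
  [&& - h <= y, y <= 2 * h - 1, - (h * k) <= x, x <= (2 * h - 1) * k,
      - ((2 * h - 1) * k) <= x + k * y & x + k * y <= h * k].

Ltac check_corners ints := rewrite /affine_form /= !toNQ_vecE !ints !andbT;
  do !(apply/andP; split); lra.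

(** The fan needs one edge at positive distance from the point: of the top
    and the bottom edge, at least one qualifies. *)
Lemma PhkP (h k : int) x : 2 <= h -> 2 <= k ->
  Phk h k x <-> hexagon h%:~R k%:~R (x 0 0) (x 1 0).
Proof.
move=> h2 k2; rewrite PhkE.
have H2 : 2 <= h%:~R :> rat by rewrite (ler_int _ 2 h).
have K2 : 2 <= k%:~R :> rat by rewrite (ler_int _ 2 k).
have ints : ((- (h * k))%:~R = - (h%:~R * k%:~R) :> rat)
   * ((1 - h)%:~R = 1 - h%:~R :> rat)
   * (((1 - h) * k)%:~R = (1 - h%:~R) * k%:~R :> rat)
   * (((2 * h - 1) * k)%:~R = (2 * h%:~R - 1) * k%:~R :> rat)
   * ((2 * h - 1)%:~R = 2 * h%:~R - 1 :> rat)
   * ((- h)%:~R = - h%:~R :> rat).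
  by do !split; ring.
move: (h%:~R) (k%:~R) H2 K2 ints => H K H2 K2 ints.
(* A product of hypotheses, which makes the goals linear in H, K and H K. *)
have HK0 : 0 <= (H - 2) * (K - 2) by apply: mulr_ge0; lra.
split=> [Px|].
  have side c1 c2 c0 :
    all (fun v => 0 <= affine_form (c1, c2, c0) (toNQ v)) (Phk_vertices h k) ->
    0 <= c1 * x 0 0 + c2 * x 1 0 + c0.
    by move=> /hull_halfplane /(_ Px).
  have S1 := side 0 1 H; have S2 := side 0 (-1) (2 * H - 1).
  have S3 := side 1 0 (H * K); have S4 := side (-1) 0 ((2 * H - 1) * K).
  have S5 := side 1 K ((2 * H - 1) * K); have S6 := side (-1) (- K) (H * K).
  have {}S1 := S1 ltac:(check_corners ints).
  have {}S2 := S2 ltac:(check_corners ints).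
  have {}S3 := S3 ltac:(check_corners ints).
  have {}S4 := S4 ltac:(check_corners ints).
  have {}S5 := S5 ltac:(check_corners ints).
  have {}S6 := S6 ltac:(check_corners ints).
  rewrite /hexagon; do !(apply/andP; split); lra.
move=> /and5P[y1 y2 x1 x2 /andP[d1 d2]].
have sub v : v \in Phk_vertices h k -> lattice_hull (Phk_vertices h k) (toNQ v).
  exact: mem_hull.
have subs (s : seq NZ) : {subset s <= Phk_vertices h k} ->
    forall v, v \in map toNQ s -> lattice_hull (Phk_vertices h k) v.
  by move=> ss _ /mapP[v vs ->]; apply: sub; apply: ss.
(* The orientations are the side inequalities times lengths of edges. *)
have T0 : 0 < 3 * H - 2 by lra.
have K0 : 0 < K by lra.
have P2 : 0 <= (3 * H - 2) * K * (x 1 0 + H).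
  by apply: mulr_ge0; [apply: mulr_ge0|]; lra.
have P4 : 0 <= (3 * H - 2) * (H * K - x 0 0 - K * x 1 0).
  by apply: mulr_ge0; lra.
have P5 : 0 <= K * (2 * H - 1 - x 1 0) by apply: mulr_ge0; lra.
have P6 : 0 <= (3 * H - 2) * (x 0 0 + H * K) by apply: mulr_ge0; lra.
have [y3|y3] := ltP (x 1 0) (2 * H - 1).
  apply: (@fan_conv _ (toNQ (vec ((1 - h) * k) (2 * h - 1)))
      (toNQ (vec (- (h * k)) (2 * h - 1)))
      (map toNQ (take 4 (Phk_vertices h k)))).
  - exact: conv_convex.
  - by apply: sub; rewrite !inE eqxx !orbT.
  - by apply: sub; rewrite !inE eqxx !orbT.
  - by apply: subs => v; apply: mem_take.
  - have P : 0 < K * (2 * H - 1 - x 1 0) by apply: mulr_gt0; lra.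
    by rewrite /orientQ !toNQ_vecE !ints; lra.
  rewrite /= /orientQ !toNQ_vecE !ints andbT; do !(apply/andP; split); lra.
apply: (@fan_conv _ (toNQ (vec ((1 - h) * k) (- h)))
      (toNQ (vec ((2 * h - 1) * k) (- h)))
      (map toNQ (rcons (drop 3 (Phk_vertices h k)) (vec (- (h * k)) (1 - h))))).
- exact: conv_convex.
- by apply: sub; rewrite !inE eqxx !orbT.
- by apply: sub; rewrite !inE eqxx !orbT.
- apply: subs => v; rewrite mem_rcons inE => /predU1P[->|]; last exact: mem_drop.
  by rewrite mem_head.
- have P : 0 < (3 * H - 2) * K * (x 1 0 + H).
    by apply: mulr_gt0; [apply: mulr_gt0|]; lra.
  by rewrite /orientQ !toNQ_vecE !ints; lra.
rewrite /= /orientQ !toNQ_vecE !ints andbT; do !(apply/andP; split); lra.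
Qed.

Lemma PhkP_int (h k : int) v : 2 <= h -> 2 <= k ->
  Phk h k (toNQ v) <-> hexagon h k (v 0 0) (v 1 0).
Proof.
move=> h2 k2; rewrite PhkP //.
suff -> : hexagon h%:~R k%:~R (toNQ v 0 0) (toNQ v 1 0)
    = hexagon h k (v 0 0) (v 1 0) by [].
rewrite !mxE /hexagon -!(ler_int rat).
by rewrite !(rmorphD, rmorphN, rmorphB, rmorphM, rmorph1).
Qed.

(** An integral linear map preserving the hexagon fixes (-k, 2). Its lower
    left entry vanishes because the lower edge of length (3h - 2) k > 3h - 1
    must keep its image within a strip of height 3h - 1; then d = 1 since the
    strip is not symmetric about 0, and the image of the lower edge leaves a
    = 1, b = 0 or a = -1, b = -k. The primed entries are those of the inverse
    matrix. *)
Lemma hexagon_endomorphism (h k a b c d a' b' c' d' : int) : 2 <= h -> 2 <= k ->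
  a * a' + b * c' = 1 -> c * a' + d * c' = 0 -> c * b' + d * d' = 1 ->
  (forall x y, hexagon h k x y -> hexagon h k (a * x + b * y) (c * x + d * y)) ->
  a * - k + b * 2 = - k /\ c * - k + d * 2 = 2.
Proof.
move=> h2 k2 i00 i10 i11 G.
have hk : 0 <= (h - 2) * (k - 2) by rewrite mulr_ge0 //; lia.
have G2 : hexagon h k (a * ((1 - h) * k) + b * - h)
    (c * ((1 - h) * k) + d * - h).
  by apply: G; rewrite /hexagon; do !(apply/andP; split); nia.
have G3 : hexagon h k (a * ((2 * h - 1) * k) + b * - h)
    (c * ((2 * h - 1) * k) + d * - h).
  by apply: G; rewrite /hexagon; do !(apply/andP; split); nia.
have G6 : hexagon h k (a * - (h * k) + b * (2 * h - 1))
    (c * - (h * k) + d * (2 * h - 1)).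
  by apply: G; rewrite /hexagon; do !(apply/andP; split); nia.
clear G; have c0 : c = 0.
  have w : 3 * h - 1 < (3 * h - 2) * k by nia.
  move: G2 G3 => /and3P[u1 u2 _] /and3P[u3 u4 _].
  have : - (3 * h - 1) <= c * ((3 * h - 2) * k) <= 3 * h - 1.
    by apply/andP; split; lia.
  by move: ((3 * h - 2) * k) w => w ww; nia.
rewrite {c}c0 !mul0r !add0r in i10 i11 G2 G3 G6 *.
have d1 : d = 1.
  case: (mulz_eq1 i11) => // E; move: G6; rewrite E => /andP[u _]; lia.
rewrite {}d1 !mul1r in i10 i11 G2 G3 G6 *.
split=> //.
rewrite i10 mulr0 addr0 in i00.
have a1 := mulz_eq1 i00.
move: G2 G3 => /and5P[u1 u2 u3 u4 /andP[u5 u6]].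
move=> /and5P[u1' u2' u3' u4' /andP[u5' u6']].
case: a1 => E; rewrite E in u3 u4 u5 u6 u3' u4' u5' u6' *.
  have : b * h = 0 by nia.
  nia.
have : (b + k) * h = 0 by nia.
nia.
Qed.

Lemma Phk_not_symmetric (h k : int) : 2 <= h -> 2 <= k ->
  ~ symmetric_polygon (Phk h k).
Proof.
move=> h2 k2 sym; have /matrixP/(_ 1 0) : toNQ (vec (- k) 2) = 0; last first.
  by rewrite !mxE /= => /eqP.
apply: sym => G [Gunit GP].
have GPi (v : NZ) : hexagon h k (v 0 0) (v 1 0) ->
    hexagon h k (G 0 0 * v 0 0 + G 0 1 * v 1 0) (G 1 0 * v 0 0 + G 1 1 * v 1 0).
  rewrite -(mulmx2E G v 0 0) -(mulmx2E G v 1 0) => /(PhkP_int v h2 k2) Pv.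
  apply/(PhkP_int _ h2 k2).
  by rewrite -GP /toNQ map_mxM; exists (toNQ v).
have inv := mulmxV Gunit; set B := invmx G in inv.
have i00 : G 0 0 * B 0 0 + G 0 1 * B 1 0 = 1 by rewrite -(mulmx2E G B) inv mxE.
have i10 : G 1 0 * B 0 0 + G 1 1 * B 1 0 = 0 by rewrite -(mulmx2E G B) inv mxE.
have i11 : G 1 0 * B 0 1 + G 1 1 * B 1 1 = 1 by rewrite -(mulmx2E G B) inv mxE.
have Gvec (a b : int) : hexagon h k a b ->
    hexagon h k (G 0 0 * a + G 0 1 * b) (G 1 0 * a + G 1 1 * b).
  by have := GPi (vec a b); rewrite !mxE.
have [e1 e2] := hexagon_endomorphism h2 k2 i00 i10 i11 Gvec.
by rewrite /toNQ -map_mxM; congr map_mx; apply: vec_ext; rewrite mulmx2E !mxE.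
Qed.

(** * Symmetries of planar Lebesgue measure *)

Section PlaneMeasure.
Variable R : realType.
Local Notation plane := (measurableTypeR R * measurableTypeR R)%type.
Local Notation leb := (@lebesgue_measure R).
Local Notation mu := (leb \x leb)%E.

Lemma lebesgue_measureD (c : R) (A : set R) : measurable A ->
  leb ((fun x : measurableTypeR R => x + c : measurableTypeR R) @^-1` A) = leb A.
Proof.
move=> mA.
pose T (x : measurableTypeR R) : measurableTypeR R := x + c.
have mT : measurable_fun setT T by exact: measurable_funD.
rewrite -[LHS]/(pushforward leb T A).
apply/esym/lebesgue_measure_unique => //= _ [[a b]] _ <-.
rewrite /pushforward.
have -> : T @^-1` `]a, b]%classic = `]a - c, b - c]%classic.
  by apply/seteqP; split=> x /=; rewrite /T !in_itv /= ltrBlDr lerBrDr.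
rewrite !lebesgue_measure_itv /= !lte_fin ltrD2r; case: ifP => // _.
by rewrite -!EFinB; congr EFin; ring.
Qed.

Definition measure_preserving (T : plane -> plane) : Prop :=
  measurable_fun setT T /\ forall X, measurable X -> mu (T @^-1` X) = mu X.

Lemma measure_preserving_comp S T :
  measure_preserving S -> measure_preserving T -> measure_preserving (S \o T).
Proof.
move=> [mS pS] [mT pT]; split; first exact: measurableT_comp.
move=> X mX; rewrite comp_preimage pT ?pS //.
by rewrite -[X in measurable X]setTI; exact: mS.
Qed.

Lemma measure_preserving_swap : measure_preserving (fun p : plane => (p.2, p.1)).
Proof.
have ms : measurable_fun setT (fun p : plane => (p.2, p.1) : plane).
  by apply: measurable_fun_pair; [exact: measurable_snd|exact: measurable_fst].
split=> // X mX.
pose m' := pushforward mu (fun p : plane => (p.2, p.1) : plane).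
apply/esym; apply: (@product_measure_unique _ _ _ _ _ _ _ m') => // A B mA mB.
transitivity (mu (B `*` A)); last by rewrite product_measure1E // muleC.
by congr (mu _); apply/seteqP; split=> -[x y] /= [].
Qed.

(** Slice by slice along the first coordinate the map is a translation, and
    the slices themselves are permuted by a reflection. *)
Lemma measure_preserving_flip_shear (c : R) :
  measure_preserving (fun p : plane => (- p.1, p.2 + c * p.1)).
Proof.
have ms : measurable_fun setT (fun p : plane => (- p.1, p.2 + c * p.1) : plane).
  apply: measurable_fun_pair; first exact: measurableT_comp.
  by apply: measurable_funD => //; apply: measurable_funM.
split=> // X mX.
rewrite /product_measure1.
transitivity (\int[leb]_x (leb (xsection X ((-%R : R -> R) x))))%E.
  apply: eq_integral => x _ /=.
  rewrite -[RHS](lebesgue_measureD (c * x)) //.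
  exact: measurable_xsection.
transitivity (\int[pushforward leb (-%R : measurableTypeR R -> measurableTypeR R)]_x
    (leb (xsection X x)))%E; last first.
  by apply: eq_measure_integral => // A mA _; exact: lebesgue_measureN.
rewrite ge0_integral_pushforward //.
exact: measurable_fun_xsection.
Qed.

(** The map exchanges the integrals of the positive and negative parts of
    [f], which are therefore equal. Should both be infinite, their difference
    is infinite by convention and its real part is 0 again. *)
Lemma Rintegral_odd (T : plane -> plane) (D : set plane) (f : plane -> R) :
  measure_preserving T -> measurable D -> measurable_fun setT f ->
  T @^-1` D = D -> (forall p, f (T p) = - f p) ->
  Rintegral mu D f = 0.
Proof.
move=> [mT pT] mD mf TD fT; rewrite /Rintegral integralE.
suff -> : (\int[mu]_(x in D) ((fun x => (f x)%:E)^\+ x) =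
    \int[mu]_(x in D) ((fun x => (f x)%:E)^\- x))%E.
  by case: (integral _ _ _) => [r| |] //=; rewrite subrr.
have mfE : measurable_fun D (fun x => (f x)%:E).
  by apply/measurable_EFinP; exact: measurable_funTS.
transitivity (\int[pushforward mu T]_(x in D) ((fun x => (f x)%:E)^\+ x))%E.
  by apply: eq_measure_integral => // A mA _; exact/esym/pT.
rewrite ge0_integral_pushforward //; last exact: measurable_funepos.
by rewrite TD; apply: eq_integral => p _; rewrite /= funeposE funenegE fT EFinN.
Qed.

End PlaneMeasure.

(** * The barycentre of the dual polygon *)

Section KahlerEinstein.
Variable R : realType.
Local Notation plane := (measurableTypeR R * measurableTypeR R)%type.

Definition dual_plane (P : set NQ) : set plane := @row2 R @^-1` dual R P.

Lemma dual_planeE P (p : plane) : dual_plane P p <->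
  forall x, P x -> -1 <= p.1 * ratr (x 0 0) + p.2 * ratr (x 1 0).
Proof.
by split=> D x /D; rewrite mulmx2E !mxE.
Qed.

Lemma dual_plane_hull s : dual_plane (lattice_hull s) =
  [set p : plane |
     all (fun v : NZ => -1 <= p.1 * (v 0 0)%:~R + p.2 * (v 1 0)%:~R) s].
Proof.
apply/seteqP; split=> p /=.
  move=> /dual_planeE D; apply/allP => v /mem_hull /D.
  by rewrite !mxE !ratr_int.
move=> /allP D; apply/dual_planeE; apply: conv_min => [x y t /= px py t0 t1|].
  rewrite !mxE !rmorphD !rmorphM rmorphB rmorph1 /=.
  have t0' : 0 <= ratr t :> R by rewrite ler0q.
  have t1' : ratr t <= 1 :> R by rewrite -(rmorph1 (@ratr R)) ler_rat.
  move: (ratr t) t0' t1' px py => u u0 u1 px py.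
  have := mulr_ge0 u0 (_ : 0 <= p.1 * ratr (x 0 0) + p.2 * ratr (x 1 0) + 1).
  have u1' : 0 <= 1 - u by lra.
  have := mulr_ge0 u1' (_ : 0 <= p.1 * ratr (y 0 0) + p.2 * ratr (y 1 0) + 1).
  by move=> /(_ ltac:(lra)) A1 /(_ ltac:(lra)) A2; lra.
by move=> _ [v /D vs <-]; rewrite /= !mxE !ratr_int.
Qed.

Lemma measurable_dual_plane_hull s : measurable (dual_plane (lattice_hull s)).
Proof.
rewrite dual_plane_hull; elim: s => [|v s IH] /=.
  by rewrite (_ : [set _ | _] = setT) //; apply/seteqP; split.
rewrite (_ : [set _ | _] =
  (fun p : plane => p.1 * (v 0 0)%:~R + p.2 * (v 1 0)%:~R) @^-1` `[-1, +oo[ `&`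
  [set p : plane |
     all (fun v : NZ => -1 <= p.1 * (v 0 0)%:~R + p.2 * (v 1 0)%:~R) s]).
  apply: measurableI => //; rewrite -[X in measurable X]setTI.
  have m : measurable_fun setT
      (fun p : plane => p.1 * (v 0 0)%:~R + p.2 * (v 1 0)%:~R : R).
    by apply: measurable_funD; apply: measurable_funM.
  exact: m.
apply/seteqP; split=> p /=; rewrite in_itv /= andbT; first by move=> /andP[].
by move=> [-> ->].
Qed.

(** Reflections in two different directions that preserve the dual polygon
    and its area annihilate both first moments. *)
Lemma kahler_einstein_odd (P : set NQ) (T1 T2 : plane -> plane) :
  measurable (dual_plane P) ->
  measure_preserving T1 -> T1 @^-1` dual_plane P = dual_plane P ->
  (forall p, (T1 p).1 = - p.1 :> R) ->
  measure_preserving T2 -> T2 @^-1` dual_plane P = dual_plane P ->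
  (forall p, (T2 p).2 = - p.2 :> R) ->
  kahler_einstein R P.
Proof.
move=> mD mT1 D1 T1E mT2 D2 T2E; rewrite /kahler_einstein /barycentre.
apply/rowP => i; rewrite !mxE.
suff -> : (\int[(lebesgue_measure \x lebesgue_measure)%E]_(p in @row2 R @^-1`
    dual R P) row2 p 0 i = 0)%R.
  by rewrite mulr0.
rewrite (_ : (fun p => row2 p 0 i) =
  (fun p : plane => if i == 0 then p.1 else p.2)); last first.
  by apply/funext => p; rewrite mxE.
case: (i == 0).
  exact: (Rintegral_odd mT1 mD measurable_fst D1 T1E).
exact: (Rintegral_odd mT2 mD measurable_snd D2 T2E).
Qed.

(** [T] is the transpose of [M], so it preserves the dual of a polygon
    preserved by [M]. *)
Lemma dual_plane_involution (P : set NQ) (T : plane -> plane) (M : NQ -> NQ) :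
  (forall x, P x -> P (M x)) -> involutive T ->
  (forall (p : plane) (x : NQ), (T p).1 * ratr (x 0 0) + (T p).2 * ratr (x 1 0) =
     p.1 * ratr (M x 0 0) + p.2 * ratr (M x 1 0) :> R) ->
  T @^-1` dual_plane P = dual_plane P.
Proof.
move=> PM TT TM; have sub p : dual_plane P p -> dual_plane P (T p).
  by move=> /dual_planeE D; apply/dual_planeE => x /PM /D; rewrite TM.
by apply/seteqP; split=> p; [move=> /sub; rewrite TT|exact: sub].
Qed.

Lemma Phk_kahler_einstein (h k : int) : 2 <= h -> 2 <= k ->
  kahler_einstein R (Phk h k).
Proof.
move=> h2 k2.
have K2 : 2 <= k%:~R :> rat by rewrite (ler_int _ 2 k).
have K2R : 2 <= k%:~R :> R by rewrite (ler_int _ 2 k).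
have KN0 : k%:~R != 0 :> R by rewrite gt_eqF //; lra.
have KN0Q : k%:~R != 0 :> rat by rewrite gt_eqF //; lra.
(* Two transpositions of the symmetric hexagon, in the present coordinates. *)
pose M1 (x : NQ) : NQ :=
  \col_i (if i == 0 then - x 0 0 - k%:~R * x 1 0 else x 1 0).
pose M2 (x : NQ) : NQ :=
  \col_i (if i == 0 then x 0 0 else - x 1 0 - x 0 0 / k%:~R).
have PM1 x : Phk h k x -> Phk h k (M1 x).
  rewrite !PhkP // !mxE /= /hexagon => /and5P[a b c d /andP[e f]].
  by do !(apply/andP; split); lra.
have PM2 x : Phk h k x -> Phk h k (M2 x).
  rewrite !PhkP // !mxE /= /hexagon => /and5P[a b c d /andP[e f]].
  have E : x 0 0 + k%:~R * (- x 1 0 - x 0 0 / k%:~R) = - (k%:~R * x 1 0).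
    by field.
  have g1 : - x 1 0 - x 0 0 / k%:~R = - (x 0 0 + k%:~R * x 1 0) / k%:~R by field.
  rewrite E g1 ler_pdivlMr ?ler_pdivrMr; try lra.
  by do !(apply/andP; split); nra.
have mswap := @measure_preserving_swap R.
have S1 := measure_preserving_flip_shear (- k%:~R : R).
(* Exchanging the coordinates before and after turns the shear of the second
   coordinate into one of the first. *)
have S2 := measure_preserving_comp mswap
  (measure_preserving_comp
     (measure_preserving_flip_shear (- k%:~R^-1 : R)) mswap).
apply: (kahler_einstein_odd _ S1 _ _ S2) => //.
- exact: measurable_dual_plane_hull.
- apply: (dual_plane_involution PM1).
    by move=> [a b] /=; congr (_, _); ring.
  by move=> p x; rewrite !mxE /= rmorphB rmorphN rmorphM /= ratr_int; ring.
- apply: (dual_plane_involution PM2).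
    by move=> [a b] /=; congr (_, _); ring.
  move=> p x; rewrite !mxE /= rmorphB rmorphN rmorphM fmorphV /= ratr_int; ring.
Qed.

End KahlerEinstein.

(** * Heights, Minkowski sums and cardinals *)

(** Membership in [C] is a convex condition in each of the two summands. *)
Lemma minkowski_hull_sub (C : set NQ) s t (c : int) : convexQ C ->
  (forall u v, u \in s -> v \in t -> C (toNQ u + c%:~R *: toNQ v)) ->
  minkowski (lattice_hull s) (dilate c (lattice_hull t)) `<=` C.
Proof.
move=> cC corners _ [a sa [_ [f tf <-] <-]]; move: a sa f tf.
suff H : lattice_hull s `<=`
    [set a | forall f, lattice_hull t f -> C (a + c%:~R *: f)].
  by move=> a sa f tf; apply: H.
apply: conv_min => [x y r /= Cx Cy r0 r1 f tf|].
  have -> : r *: x + (1 - r) *: y + c%:~R *: f =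
    r *: (x + c%:~R *: f) + (1 - r) *: (y + c%:~R *: f).
    by apply: vec_ext; rewrite !mxE; ring.
  by apply: cC => //; [exact: Cx|exact: Cy].
move=> _ [u us <-] /=; apply: conv_min => [x y r /= Cx Cy r0 r1|].
  have -> : toNQ u + c%:~R *: (r *: x + (1 - r) *: y) =
    r *: (toNQ u + c%:~R *: x) + (1 - r) *: (toNQ u + c%:~R *: y).
    by apply: vec_ext; rewrite !mxE; ring.
  exact: cC.
by move=> _ [v vt <-]; apply: corners.
Qed.

Lemma finite_not_card_le_setD1 (T : choiceType) (A : set T) a :
  finite_set A -> A a -> ~ (A #<= A `\ a).
Proof.
move=> fA Aa AD; have : A #= A `\ a by rewrite card_eq_le AD card_le_setD.
move=> /(fcard_eq fA (finite_setD _ fA)); rewrite fset_setD1 //.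
rewrite (@finmap.cardfsD1 _ a) in_fset_set // mem_set // => /eqP.
by rewrite eqn_leq ltnn.
Qed.

Lemma hminE w P m : (height w @` P) m%:~R ->
  (forall x, P x -> m%:~R <= height w x) -> hmin w P = m.
Proof.
move=> [x Px xm] Pm; apply: xget_unique => [|n [[y Py yn] Pn]].
  by split=> //; exists x.
apply/eqP; rewrite eq_le -!(ler_int rat).
by rewrite -{1}xm (Pn x Px) -yn (Pm y Py).
Qed.

Lemma hmaxE w P m : (height w @` P) m%:~R ->
  (forall x, P x -> height w x <= m%:~R) -> hmax w P = m.
Proof.
move=> [x Px xm] Pm; apply: xget_unique => [|n [[y Py yn] Pn]].
  by split=> //; exists x.
apply/eqP; rewrite eq_le -!(ler_int rat).
by rewrite -{2}xm (Pn x Px) -yn (Pm y Py).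
Qed.

(** * The mutation and the lattice points on its boundary *)

(** The form w of the mutation. Its heights are -y, so the rows shortened by
    the mutation are those with y > 0, up to the short top edge. *)
Definition downward : MZ := \row_i (if i == 0 then 0 else -1).

Lemma height_down x : height downward x = - x 1 0.
Proof. by rewrite /height mulmx2E !mxE /= !mul0r add0r mulN1r. Qed.

Lemma layer_down (n : int) (v : NZ) : (downward *m v) 0 0 = n <-> v 1 0 = - n.
Proof. rewrite mulmx2E !mxE /= mul0r add0r mulN1r; split; lia. Qed.

(** The lattice points on four of the six sides. The other two sides join
    neighbouring rows and contribute no further lattice point, so this loses
    nothing in the count. *)
Definition Phk_boundary (h k : int) : set NZ :=
  [set v | hexagon h k (v 0 0) (v 1 0) &&
    [|| v 1 0 == - h, v 1 0 == 2 * h - 1,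
     v 0 0 == - (h * k) | v 0 0 + k * v 1 0 == h * k]].

(** The same rows and left-hand side for the mutated polygon, whose
    right-hand side is sheared by (x, y) |-> (x - y, y). *)
Definition mutation_boundary (h k : int) : set NZ :=
  [set v | [&& - h <= v 1 0, v 1 0 <= 2 * h - 1, - (h * k) <= v 0 0,
      - ((2 * h - 1) * k) <= v 0 0 + k * v 1 0,
      v 0 0 + v 1 0 <= (2 * h - 1) * k & v 0 0 + v 1 0 + k * v 1 0 <= h * k] &&
    [|| v 1 0 == - h, v 1 0 == 2 * h - 1,
     v 0 0 == - (h * k) | v 0 0 + v 1 0 + k * v 1 0 == h * k]].

Section Mutation.
Variables h k : int.
Hypotheses (h2 : 2 <= h) (k2 : 2 <= k) (kh : 2 * h - 1 <= k).
Let P := Phk h k.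

Lemma hmin_Phk : hmin downward P = - (2 * h - 1).
Proof.
apply: hminE.
  exists (toNQ (vec (- (h * k)) (2 * h - 1))).
    by apply: mem_hull; rewrite !inE eqxx !orbT.
  by rewrite height_down toNQ_vecE rmorphN.
move=> x /(PhkP _ h2 k2) /and3P[_ y _].
rewrite height_down rmorphN rmorphB rmorphM /=; lra.
Qed.

Lemma hmax_Phk : hmax downward P = h.
Proof.
apply: hmaxE.
  exists (toNQ (vec ((1 - h) * k) (- h))).
    by apply: mem_hull; rewrite !inE eqxx !orbT.
  by rewrite height_down toNQ_vecE rmorphN opprK.
by move=> x /(PhkP _ h2 k2) /andP[y _]; rewrite height_down; lra.
Qed.

(** The corners of the factor F of the mutation. *)
Definition segment : seq NZ := [:: vec 0 0; vec 1 0].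

(** The row of height [n] with [- n] lattice units removed on the right:
    adding |n| times the factor gives back the whole row. *)
Definition remainder (n : int) : seq NZ :=
  [:: vec (- (h * k)) (- n); vec (h * k + k * n + n) (- n)].

Definition mutated_polygon : set NQ :=
  mutation downward P (lattice_hull segment)
    (fun n => lattice_hull (remainder n)).

Let Q := mutated_polygon.

Lemma slice_mem n (v : NZ) : hexagon h k (v 0 0) (v 1 0) -> v 1 0 = - n ->
  slice downward P n (toNQ v).
Proof.
move=> Hv vn; apply: sub_conv; split; first exact/PhkP_int.
by exists v => //; apply/layer_down.
Qed.

(** The row of height [n] is long enough to be shortened; this is where [2 *
    h - 1 <= k] enters. *)
Lemma row_bound n : - (2 * h - 1) <= n -> n < 0 -> - (h * k) - n <= h * k + k * n.
Proof.
move=> n1 n2; have : 0 <= (2 * h - 1 + n) * (k + 1) by rewrite mulr_ge0 //; lia.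
lia.
Qed.

Lemma factor_segment : factor_witness downward P (lattice_hull segment)
  (fun n => lattice_hull (remainder n)).
Proof.
move=> n; rewrite hmin_Phk => n1 n2; split.
- by exists (remainder n).
- move=> x [+ [v /layer_down vn xE]]; rewrite -{x}xE => /vertex_hull vP.
  have : v = vec ((1 - h) * k) (2 * h - 1) \/ v = vec (- (h * k)) (2 * h - 1).
    move: vP vn; rewrite !inE => /or4P[/eqP->|/eqP->|/eqP->|] //;
      try (rewrite !mxE /=; lia).
    by move=> /or3P[/eqP->|/eqP->|/eqP->] //;
      [rewrite !mxE /=; lia|left|right].
  (* Only the two ends of the top edge are vertices of negative height. *)
  move=> vE; have nE : n = - (2 * h - 1).
    by case: vE vn => ->; rewrite !mxE /=; lia.
  case: vE => vE.
    exists (toNQ (vec (h * k + k * n + n) (- n))).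
      by apply: mem_hull; rewrite !inE eqxx orbT.
    exists (`|n|%:~R *: toNQ (vec 1 0)).
      by exists (toNQ (vec 1 0)) => //; apply: mem_hull; rewrite !inE eqxx orbT.
    rewrite vE ltr0_norm // nE; apply: vec_ext; rewrite !mxE /=.
      by rewrite -intrM -intrD; congr (_%:~R); ring.
    by rewrite mulr0 addr0; congr (_%:~R); ring.
  exists (toNQ (vec (- (h * k)) (- n))).
    by apply: mem_hull; rewrite !inE eqxx.
  exists (`|n|%:~R *: toNQ (vec 0 0)).
    by exists (toNQ (vec 0 0)) => //; apply: mem_hull; rewrite !inE eqxx.
  by rewrite vE nE; apply: vec_ext; rewrite !mxE /= mulr0 addr0 ?opprK.
apply: minkowski_hull_sub => [|u v us vs]; first exact: conv_convex.
have -> : toNQ u + `|n|%:~R *: toNQ v = toNQ (u + `|n| *: v).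
  by apply: vec_ext; rewrite !mxE intrD intrM.
have nk := row_bound n1 n2.
have knm : 0 <= k * (- n - 1) by rewrite mulr_ge0 //; lia.
have knM : 0 <= k * (2 * h - 1 + n) by rewrite mulr_ge0 //; lia.
have hk0 : 0 <= (h - 2) * (k - 2) by rewrite mulr_ge0 //; lia.
apply: slice_mem; move: us vs; rewrite !inE ltr0_norm //;
  move=> /orP[] /eqP-> /orP[] /eqP->; rewrite !mxE /= ?mulr0 ?addr0 //.
all: rewrite /hexagon; do !(apply/andP; split); lia.
Qed.

(** For k = 2h - 1 the last corner coincides with the first. *)
Definition mutation_vertices : seq NZ :=
  [:: vec (- (h * k)) (2 * h - 1); vec (- (h * k)) (1 - h);
      vec ((1 - h) * k) (- h); vec ((2 * h - 1) * k + h) (- h);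
      vec ((2 * h - 1) * k + (h - 1)) (1 - h);
      vec ((1 - h) * k - (2 * h - 1)) (2 * h - 1)].

Lemma mem_mutation : {in mutation_vertices, forall v, Q (toNQ v)}.
Proof.
have memQ (n : int) y : - (2 * h - 1) <= n < 0 ->
    lattice_hull (remainder n) y -> Q y.
  by move=> nh Ry; apply: sub_conv; left; exists n => //=; rewrite hmin_Phk.
have memQ' (n : int) (u v : NZ) : 0 <= n <= h ->
    hexagon h k (u 0 0) (u 1 0) -> u 1 0 = - n ->
    v \in segment -> Q (toNQ (u + n *: v)).
  move=> nh uP un vS; apply: sub_conv; right; exists n.
    by rewrite /= hmax_Phk.
  exists (toNQ u); first exact: slice_mem.
  exists (n%:~R *: toNQ v).
    by exists (toNQ v) => //; apply: mem_hull.
  by apply: vec_ext; rewrite !mxE intrD intrM.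
have hk0 : 0 <= (h - 2) * (k - 2) by rewrite mulr_ge0 //; lia.
have Q1 : Q (toNQ (vec (- (h * k)) (1 - h))).
  rewrite (_ : vec _ _ = vec (- (h * k)) (1 - h) + (h - 1) *: vec 0 0); last first.
    by rewrite vecZ vecD !mulr0 !addr0.
  apply: memQ'; rewrite ?mxE /= ?inE ?eqxx //; try lia.
  by rewrite /hexagon; do !(apply/andP; split); lia.
have Q2 : Q (toNQ (vec ((1 - h) * k) (- h))).
  rewrite (_ : vec _ _ = vec ((1 - h) * k) (- h) + h *: vec 0 0); last first.
    by rewrite vecZ vecD !mulr0 !addr0.
  apply: memQ'; rewrite ?mxE /= ?inE ?eqxx //; try lia.
  by rewrite /hexagon; do !(apply/andP; split); lia.
have Q3 : Q (toNQ (vec ((2 * h - 1) * k + h) (- h))).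
  rewrite (_ : vec _ _ = vec ((2 * h - 1) * k) (- h) + h *: vec 1 0); last first.
    by rewrite vecZ vecD mulr0 mulr1 addr0.
  apply: memQ'; rewrite ?mxE /= ?inE ?eqxx ?orbT //; try lia.
  by rewrite /hexagon; do !(apply/andP; split); lia.
have Q4 : Q (toNQ (vec ((2 * h - 1) * k + (h - 1)) (1 - h))).
  rewrite (_ : vec _ _ = vec ((2 * h - 1) * k) (1 - h) + (h - 1) *: vec 1 0); last first.
    by rewrite vecZ vecD mulr0 mulr1 addr0.
  apply: memQ'; rewrite ?mxE /= ?inE ?eqxx ?orbT //; try lia.
  by rewrite /hexagon; do !(apply/andP; split); lia.
have Q5 : Q (toNQ (vec ((1 - h) * k - (2 * h - 1)) (2 * h - 1))).
  apply: (memQ (- (2 * h - 1))); first lia.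
  by apply: mem_hull; rewrite !inE; apply/orP; right; apply/eqP; congr vec; ring.
have Q6 : Q (toNQ (vec (- (h * k)) (2 * h - 1))).
  apply: (memQ (- (2 * h - 1))); first lia.
  by apply: mem_hull; rewrite !inE; apply/orP; left; apply/eqP; congr vec; ring.
by move=> v; rewrite !inE =>
  /or4P[/eqP->|/eqP->|/eqP->|/or3P[/eqP->|/eqP->|/eqP->]].
Qed.

Definition mutation_sides : seq (rat * rat * rat) :=
  let H := h%:~R in let K := k%:~R in
  [:: (1, 0, H * K); (1, K, (2 * H - 1) * K); (0, 1, H); (0, -1, 2 * H - 1);
      (-1, -1, (2 * H - 1) * K); (-1, - (K + 1), H * K)].

Let H2 : 2 <= h%:~R :> rat. Proof. by rewrite (ler_int _ 2 h). Qed.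
Let K2 : 2 <= k%:~R :> rat. Proof. by rewrite (ler_int _ 2 k). Qed.
Let KH : 2 * h%:~R - 1 <= k%:~R :> rat.
Proof. by have := kh; rewrite -(ler_int rat) rmorphB rmorphM. Qed.

Lemma slice_sub n x : slice downward P n x ->
  hexagon h%:~R k%:~R (x 0 0) (x 1 0) /\ x 1 0 = - n%:~R.
Proof.
move=> Sx; split.
  apply/(PhkP _ h2 k2); apply: (conv_min (@conv_convex _) _ Sx).
  by move=> y [].
have row y : (P `&` layer downward n) y -> y 1 0 = - n%:~R.
  by move=> [_ [v /layer_down vn <-]]; rewrite mxE vn rmorphN.
have := @conv_halfplane _ (0, 1, n%:~R) _ x Sx.
have := @conv_halfplane _ (0, -1, - n%:~R) _ x Sx.
rewrite /affine_form /= => L1 L2.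
have {}L1 : 0 <= 0 * x 0 0 + (-1) * x 1 0 + - n%:~R.
  by apply: L1 => y /row ->; lra.
have {}L2 : 0 <= 0 * x 0 0 + 1 * x 1 0 + n%:~R.
  by apply: L2 => y /row ->; lra.
lra.
Qed.

Lemma segment_sub x : lattice_hull segment x ->
  [/\ 0 <= x 0 0, x 0 0 <= 1 & x 1 0 = 0].
Proof.
move=> Sx.
have L c := @hull_halfplane segment c x ^~ Sx.
have := L (1, 0, 0); have := L (-1, 0, 1).
have := L (0, 1, 0); have := L (0, -1, 0).
rewrite /= /affine_form /= !toNQ_vecE.
move=> /(_ isT) L1 /(_ isT) L2 /(_ isT) L3 /(_ isT) L4.
by split; lra.
Qed.

Lemma mutation_sub :
  Q `<=` [set x | all (fun c => 0 <= affine_form c x) mutation_sides].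
Proof.
have [hq [kq khq]] := (H2, (K2, KH)).
have hk0 : 0 <= (h%:~R - 2) * (k%:~R - 2) :> rat by apply: mulr_ge0; lra.
apply: conv_min; first exact: halfplanes_convex.
move=> x [[n /= /andP[]]|[n /= /andP[]]].
  rewrite hmin_Phk => n1 n2; move: x.
  apply: (conv_min (@halfplanes_convex mutation_sides)) => _ [v vR <-].
  have := row_bound n1 n2.
  rewrite -(ler_int rat) !(rmorphB, rmorphN, rmorphD, rmorphM) /= => B.
  have N1 : n%:~R <= -1 :> rat by rewrite (ler_int _ n (-1)); lia.
  have N2 : - (2 * h%:~R - 1) <= n%:~R :> rat.
    by move: n1; rewrite -(ler_int rat) !(rmorphB, rmorphN, rmorphM).
  have KN : 0 <= k%:~R * (- 1 - n%:~R) :> rat by apply: mulr_ge0; lra.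
  have KN' : 0 <= k%:~R * (2 * h%:~R - 1 + n%:~R) :> rat.
    by apply: mulr_ge0; lra.
  move: vR => /=; rewrite !inE => /orP[] /eqP->;
    rewrite /affine_form /= !toNQ_vecE;
    rewrite !(rmorphB, rmorphN, rmorphD, rmorphM) /= andbT;
    do !(apply/andP; split); lra.
rewrite hmax_Phk => n1 n2.
move=> [p /slice_sub[Hp pn] [_ [f /segment_sub[f0 f1 fy] <-] <-]].
have N0 : 0 <= n%:~R :> rat by rewrite (ler_int _ 0 n).
have F0 : 0 <= n%:~R * f 0 0 by apply: mulr_ge0.
have F1 : 0 <= n%:~R * (1 - f 0 0) by apply: mulr_ge0 => //; lra.
move: Hp; rewrite /hexagon => /and5P[y1 y2 x1 x2 /andP[d1 d2]].
rewrite /= /affine_form /= !mxE fy mulr0 addr0 andbT.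
do !(apply/andP; split); lra.
Qed.

(** Only interior points are wanted, so the inequalities are strict and the
    fan can start at any edge of positive length; the last edge is a point
    for k = 2h - 1. *)
Lemma mutation_sup x :
  all (fun c => 0 < affine_form c x) mutation_sides -> Q x.
Proof.
have [hq [kq khq]] := (H2, (K2, KH)).
rewrite /= /affine_form /= => /and5P[x1 d1 y1 y2 /and3P[x2 d2 _]].
have cQ : convexQ Q by exact: conv_convex.
have Q6 : Q (toNQ (vec (- (h * k)) (2 * h - 1))).
  by apply: mem_mutation; rewrite !inE eqxx.
have Q1 : Q (toNQ (vec (- (h * k)) (1 - h))).
  by apply: mem_mutation; rewrite !inE eqxx orbT.
apply: (fan_conv cQ Q6 Q1 (s := map toNQ (drop 2 mutation_vertices))).
- by move=> _ /mapP[v /mem_drop vV ->]; apply: mem_mutation.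
- rewrite /orientQ !toNQ_vecE !(rmorphB, rmorphN, rmorphD, rmorphM, rmorph1) /=.
  have : 0 < (3 * h%:~R - 2) * (x 0 0 + h%:~R * k%:~R).
    by apply: mulr_gt0; lra.
  lra.
rewrite /= /orientQ !toNQ_vecE.
rewrite !(rmorphB, rmorphN, rmorphD, rmorphM, rmorph1) /= andbT.
have T0 : 0 <= 3 * h%:~R - 2 :> rat by lra.
have T2 : 0 <= ((3 * h%:~R - 2) * k%:~R + h%:~R) * (x 1 0 + h%:~R).
  by apply: mulr_ge0; [apply: addr_ge0; [apply: mulr_ge0|]|]; lra.
have T4 : 0 <= (3 * h%:~R - 2) * (h%:~R * k%:~R - x 0 0 - (k%:~R + 1) * x 1 0).
  by apply: mulr_ge0 => //; lra.
have T5 : 0 <= (k%:~R - (2 * h%:~R - 1)) * (2 * h%:~R - 1 - x 1 0).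
  by apply: mulr_ge0; lra.
do !(apply/andP; split); lra.
Qed.

Lemma boundary_mutation (v : NZ) : boundary Q (toNQ v) ->
  all (fun c => 0 <= affine_form c (toNQ v)) mutation_sides /\
  has (fun c => affine_form c (toNQ v) == 0) mutation_sides.
Proof.
move=> [/mutation_sub Qv nint]; split=> //; apply: contrapT => /negP noz.
apply: nint; apply: (@interior_halfplanes _ mutation_sides) => [x xs|c cs].
  by apply: mutation_sup; apply/allP.
rewrite lt_def (allP Qv) // andbT; apply: contra noz => c0.
by apply/hasP; exists c.
Qed.

Lemma Phk_boundary_sub :
  Phk_boundary h k `<=` boundary_lattice_points P.
Proof.
move=> v /= /andP[Hv edge]; split; first exact/PhkP_int.
have supp (c : rat * rat * rat) : (c.1.1 != 0) || (c.1.2 != 0) ->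
    (forall x : NQ, hexagon h%:~R k%:~R (x 0 0) (x 1 0) ->
       0 <= affine_form c x) ->
    affine_form c (toNQ v) = 0 -> ~ strict_interior (Phk h k) (toNQ v).
  move=> cN0 cP; apply: supporting_line_not_interior => // y /PhkP; auto.
case/or4P: edge => /eqP e.
- apply: (supp (0, 1, h%:~R)) => //= [x /andP[y1 _]|];
    rewrite /affine_form /=; first lra.
  by rewrite !mxE e rmorphN; ring.
- apply: (supp (0, -1, 2 * h%:~R - 1)) => //= [x /and3P[_ y1 _]|];
    rewrite /affine_form /=; first lra.
  by rewrite !mxE e; ring.
- apply: (supp (1, 0, h%:~R * k%:~R)) => //= [x /and4P[_ _ y1 _]|];
    rewrite /affine_form /=; first lra.
  by rewrite !mxE e; ring.
- apply: (supp (-1, - k%:~R, h%:~R * k%:~R)) =>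
    //= [x /and5P[_ _ _ _ /andP[_ y1]]|].
    by rewrite /affine_form /=; lra.
  by rewrite /affine_form /= !mxE -[h%:~R * _]rmorphM -e; ring.
Qed.

Lemma mutation_boundary_sup :
  boundary_lattice_points Q `<=` mutation_boundary h k.
Proof.
move=> v /boundary_mutation [].
rewrite /mutation_boundary /= /affine_form /= !mxE; move: (v 0 0) (v 1 0) => x y.
have -> : 1 * x%:~R + 0 * y%:~R + h%:~R * k%:~R = (x + h * k)%:~R :> rat by ring.
have -> : 1 * x%:~R + k%:~R * y%:~R + (2 * h%:~R - 1) * k%:~R
  = (x + k * y + (2 * h - 1) * k)%:~R :> rat by ring.
have -> : 0 * x%:~R + 1 * y%:~R + h%:~R = (y + h)%:~R :> rat by ring.
have -> : 0 * x%:~R + -1 * y%:~R + (2 * h%:~R - 1)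
  = (2 * h - 1 - y)%:~R :> rat by ring.
have -> : -1 * x%:~R + -1 * y%:~R + (2 * h%:~R - 1) * k%:~R
  = ((2 * h - 1) * k - x - y)%:~R :> rat by ring.
have -> : -1 * x%:~R + - (k%:~R + 1) * y%:~R + h%:~R * k%:~R
  = (h * k - x - y - k * y)%:~R :> rat by ring.
rewrite !ler0z !intr_eq0.
move=> /and5P[x1 d1 y1 y2 /and3P[x2 d2 _]] edge.
apply/andP; split; first by do !(apply/andP; split); lia.
(* On the two lower slanted sides only the end points are lattice points. *)
have low : k * (y - (1 - h)) <= 0 -> y = - h \/ y = 1 - h.
  by rewrite pmulr_rle0; lia.
case/or4P: edge => [e|e|e|];
  try (apply/or4P; first [by constructor 1; lia
    |by constructor 2; lia|by constructor 3; lia]).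
  have [->|yE] : y = - h \/ y = 1 - h by apply: low; lia.
    by rewrite eqxx.
  by apply/or4P; constructor 3; rewrite yE in e; lia.
move=> /or3P[e|e|];
  try (apply/or4P; first [by constructor 2; lia|by constructor 4; lia]).
  have [->|yE] : y = - h \/ y = 1 - h by apply: low; lia.
    by rewrite eqxx.
  by apply/or4P; constructor 4; rewrite yE in e *; lia.
by rewrite orbF => e; apply/or4P; constructor 4; lia.
Qed.

Lemma finite_Phk_boundary : finite_set (Phk_boundary h k).
Proof.
pose f (ij : nat * nat) : NZ := vec (ij.1%:Z - h * k) (ij.2%:Z - h).
pose width := absz ((3 * h - 1) * k); pose height := absz (3 * h - 1)%R.
pose box := `I_width.+1 `*` `I_height.+1.
suff sub : Phk_boundary h k `<=` f @` box.
  apply: sub_finite_set sub _.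
  by apply/finite_image/finite_setX; apply: finite_II.
move=> v /andP[/and5P[y1 y2 x1 x2 _] _].
exists (absz (v 0 0 + h * k), absz (v 1 0 + h)).
  rewrite /box /width /height; move: (v 0 0) (v 1 0) y1 y2 x1 x2 => x y *.
  by split => /=; lia.
rewrite [RHS]vec_eta /f; move: (v 0 0) (v 1 0) y1 y2 x1 x2 => x y *.
by congr vec => /=; lia.
Qed.

(** The injection that compares the two boundaries. It undoes the shear on
    the right-hand side and moves the [h] extra points of the bottom row to
    the right end of the top row, where the mutation had removed [2 * h - 1 >
    h] points. *)
Definition boundary_map (v : NZ) : NZ :=
  if v 1 0 == - h then
    if v 0 0 <= (2 * h - 1) * k then v
    else vec (v 0 0 - (3 * h - 2) * k - (2 * h - 1)) (2 * h - 1)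
  else if (v 1 0 == 2 * h - 1) || (v 0 0 == - (h * k)) then v
  else vec (v 0 0 + v 1 0) (v 1 0).

(** The right end of the top edge is missed, so the injection is not onto. *)
Lemma boundary_map_mem v : mutation_boundary h k v ->
  (Phk_boundary h k `\ vec ((1 - h) * k) (2 * h - 1)) (boundary_map v).
Proof.
have hk0 : 0 <= (h - 2) * (k - 2) by rewrite mulr_ge0 //; lia.
rewrite (vec_eta v) /mutation_boundary /boundary_map /= !mxE /=.
move: (v 0 0) (v 1 0) => {v} x y.
move=> /andP[/and5P[y1 y2 x1 d1 /andP[x2 d2]] edge].
have ky : 0 <= k * (y + h) by rewrite mulr_ge0 //; lia.
have ky' : 0 <= (k + 1) * (2 * h - 1 - y) by rewrite mulr_ge0 //; lia.
case: eqP => [yE|/eqP yN].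
  subst y; case: (lerP x ((2 * h - 1) * k)) => xk.
    split; last by move=> /vec_inj[]; lia.
    rewrite /Phk_boundary /= !mxE /= eqxx andbT.
    by rewrite /hexagon; do !(apply/andP; split); lia.
  split; last by move=> /vec_inj[]; lia.
  rewrite /Phk_boundary /= !mxE /= eqxx orbT andbT.
  by rewrite /hexagon; do !(apply/andP; split); lia.
case: eqP => [yE|/eqP yN'] /=.
  subst y; split; last by move=> /vec_inj[]; lia.
  rewrite /Phk_boundary /= !mxE /= eqxx orbT andbT.
  by rewrite /hexagon; do !(apply/andP; split); lia.
have ky2 : 0 <= k * (2 * h - 1 - y) by rewrite mulr_ge0 //; lia.
have ky1 : 0 <= k * (y + h - 1) by rewrite mulr_ge0 //; lia.
case: eqP => [xE|/eqP xN].
  split; last by move=> /vec_inj[]; lia.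
  rewrite /Phk_boundary /= !mxE /= xE eqxx !orbT andbT.
  by rewrite /hexagon; do !(apply/andP; split); lia.
split; last by move=> /vec_inj[]; lia.
move: edge; rewrite (negbTE yN) (negbTE yN') (negbTE xN) /= => edge.
rewrite /Phk_boundary /= !mxE /= edge !orbT andbT.
by rewrite /hexagon; do !(apply/andP; split); lia.
Qed.

(** On a row strictly below the top one the left and right boundary points
    differ, since (k + 1) y < 2 h k there; hence un-shearing the right one
    cannot produce the left one. *)
Lemma boundary_map_inj :
  {in mutation_boundary h k &, injective boundary_map}.
Proof.
have hk0 : 0 <= (h - 2) * (k - 2) by rewrite mulr_ge0 //; lia.
move=> u v /set_mem + /set_mem; rewrite (vec_eta u) (vec_eta v).
rewrite /mutation_boundary /boundary_map /= !mxE /=.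
move: (u 0 0) (u 1 0) (v 0 0) (v 1 0) => {u v} a b c d.
move=> /andP[/and5P[uy1 uy2 ux1 ud1 /andP[ux2 ud2]] uedge].
move=> /andP[/and5P[vy1 vy2 vx1 vd1 /andP[vx2 vd2]] vedge].
have below y : y != 2 * h - 1 -> y <= 2 * h - 1 -> (k + 1) * y < 2 * h * k.
  move=> yN y2; have : 0 <= (k + 1) * (2 * h - 2 - y) by rewrite mulr_ge0 //; lia.
  lia.
case: (eqVneq b (- h)) => [->|bN]; case: (eqVneq d (- h)) => [->|dN].
- by case: lerP => ah; case: lerP => ch /vec_inj[e1 e2]; congr vec; lia.
- case: lerP => ah; case: ifP => dN' /vec_inj[e1 e2]; try (congr vec; lia).
- by case: ifP => bN'; case: lerP => ch /vec_inj[e1 e2]; congr vec; lia.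
have {}bN : b == 2 * h - 1 \/ (k + 1) * b < 2 * h * k.
  by case: eqVneq => [|b1]; [left|right; apply: below].
have {}dN : d == 2 * h - 1 \/ (k + 1) * d < 2 * h * k.
  by case: eqVneq => [|d1]; [left|right; apply: below].
case: ifP => bN'; case: ifP => dN' /vec_inj[e1 e2]; congr vec; try lia.
all: subst d; lia.
Qed.

Lemma Phk_not_minimal : ~ minimal_polygon (Phk h k).
Proof.
move=> /(_ Q) min.
have {}min : boundary_lattice_points P #<= boundary_lattice_points Q.
  apply: min; exists downward, (lattice_hull segment),
    (fun n => lattice_hull (remainder n)).
  split=> //.
  - by rewrite /primitive_form !mxE.
  - by exists segment.
  - apply/seteqP; split=> [_ [x /segment_sub[_ _ x1] <-]|_ ->].
      by rewrite height_down x1 oppr0.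
    exists (toNQ (vec 0 0)); first by apply: mem_hull; rewrite mem_head.
    by rewrite height_down toNQ_vecE oppr0.
  - exact: factor_segment.
pose v5 := vec ((1 - h) * k) (2 * h - 1).
apply: (@finite_not_card_le_setD1 _ _ v5 finite_Phk_boundary).
  have hk0 : 0 <= (h - 2) * (k - 2) by rewrite mulr_ge0 //; lia.
  rewrite /Phk_boundary /= !mxE /hexagon /= eqxx orbT andbT.
  by do !(apply/andP; split); lia.
(* The chain below would embed the explicit boundary into itself minus a corner. *)
apply: card_le_trans (subset_card_le Phk_boundary_sub) _.
apply: card_le_trans min _.
apply: card_le_trans (subset_card_le mutation_boundary_sup) _.
have := inj_card_eq boundary_map_inj.
rewrite card_eq_sym card_eq_le => /andP[+ _].
move=> /card_le_trans; apply; apply: subset_card_le => _ [v vQ <-].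
exact: boundary_map_mem.
Qed.

End Mutation.

Unset Implicit Arguments.

Theorem proposition5p11 (R : realType) (h k : int)
    (hge2 : 2 <= h) (kge2 : 2 <= k)
    (kh : coprimez k h) (kh1 : coprimez k (h - 1))
    (k2h1 : coprimez k (2 * h - 1)) :
  [/\ fano (Phk h k), kahler_einstein R (Phk h k),
      ~ symmetric_polygon (Phk h k),
      type_Binfty (Phk h k) &
      (2 * h - 1 <= k -> ~ minimal_polygon (Phk h k))].
Proof.
have [m kE] := odd_of_coprimez kh kh1; split.
- exact: Phk_fano.
- exact: Phk_kahler_einstein.
- exact: Phk_not_symmetric.
- exact: (Phk_type_Binfty hge2 kge2 kE).
- exact: Phk_not_minimal.
Qed.
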